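(* Let $n\geq 3$ and let $X\subset \mathbb{P}^n$ be a reduced hypersurface of degree $d\geq 2$ over $\mathbb{F}_q$. Suppose that $q\geq d(d-1)+1$. Then, for every $2\leq r\leq n-1$, there exists an $r$-plane $T\subset\mathbb{P}^n$ defined over $\mathbb{F}_q$ such that $X\cap T$ is reduced and has the expected dimension $r-1$.
   Context: An $r$-plane is an $r$-dimensional linear subspace of $\mathbb{P}^n$. $X\cap T$ denotes the scheme-theoretic intersection; reduced means no nonzero nilpotents (equivalently over $\mathbb{F}_q$ or $\overline{\mathbb{F}_q}$). *)

(* Defs.v *)
From mathcomp Require Import all_boot all_order all_algebra.
From mathcomp Require Export mpoly.

Set Implicit Arguments.
Unset Strict Implicit.
Unset Printing Implicit Defensive.

Import GRing.Theory.
Local Open Scope ring_scope.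

Section CommutativeAlgebra.
Variable R : comNzRingType.

Definition ideal_gen (S : R -> Prop) (p : R) : Prop :=
  exists2 s : seq (R * R),
    forall cg, cg \in s -> S cg.2 & p = \sum_(cg <- s) cg.1 * cg.2.

(* R / J has no nonzero nilpotents; it may be the zero ring *)
Definition reduced_quotient (J : R -> Prop) : Prop :=
  forall (p : R) (m : nat), J (p ^+ m) -> J p.

(* P 0 < ... < P l is a chain of length l of prime ideals of R / J, seen as
   prime ideals of R containing J (idealr_closed includes 1 \notin P i) *)
Definition prime_chain (J : R -> Prop) (l : nat) (P : nat -> {pred R}) : Prop :=
  [/\ forall i, (i <= l)%N -> idealr_closed (P i) /\ prime_idealr_closed (P i),
      forall p, J p -> p \in P 0%N
    & forall i, (i < l)%N ->
        {subset P i <= P i.+1} /\ exists2 p, p \in P i.+1 & p \notin P i].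

End CommutativeAlgebra.

Section ProjectiveSchemes.
Variables (K : fieldType) (n : nat).

(* A closed subscheme of P^n is given by a set of homogeneous equations in
   the n.+1 homogeneous coordinates. *)
Definition proj_eqs := {mpoly K[n.+1]} -> Prop.

Definition hypersurface (f : {mpoly K[n.+1]}) : proj_eqs := fun p => p = f.

(* The projectivisation of a linear subspace W of K^(n+1), of projective
   dimension \dim W - 1, cut out by the linear forms that vanish on W. *)
Definition linear_subscheme (W : {vspace 'rV[K]_n.+1}) : proj_eqs :=
  fun p => exists2 c : 'rV[K]_n.+1,
    p = \sum_(i < n.+1) c 0 i *: 'X_i
    & forall w, w \in W -> \sum_(i < n.+1) c 0 i * w 0 i = 0.

Definition scheme_inter (Y Z : proj_eqs) : proj_eqs := fun p => Y p \/ Z p.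

(* The coordinate ring of Z on the standard affine open set x_i <> 0 is
   K[x_0, ..., x_n] / (Z, x_i - 1); these open sets cover P^n. *)
Definition chart_ideal (Z : proj_eqs) (i : 'I_n.+1) : {mpoly K[n.+1]} -> Prop :=
  ideal_gen (fun p => Z p \/ p = 'X_i - 1).

Definition reduced_scheme (Z : proj_eqs) : Prop :=
  forall i, reduced_quotient (chart_ideal Z i).

(* dim Z = m, the dimension being the maximum of the Krull dimensions of the
   charts; no natural number is the dimension of the empty scheme. *)
Definition has_dim (Z : proj_eqs) (m : nat) : Prop :=
  (exists i P, prime_chain (chart_ideal Z i) m P) /\
  (forall i l P, prime_chain (chart_ideal Z i) l P -> (l <= m)%N).

End ProjectiveSchemes.

(* Main.v *)
From HB Require Import structures.
Require Import Defs.
From mathcomp Require Import all_boot all_order all_algebra all_field perm.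
From mathcomp Require Import ring zify.
From mathcomp Require boolp classical_sets.

(** Some line L of P^n defined over F_q meets X transversally, that is, the
    restriction of f to L is a binary form of degree d without multiple roots.
    Any r-plane T that contains L then has the required properties, because the
    restriction g of f to T is still separable along L.

    Existence of L. The equation f generates a radical ideal of the polynomial
    ring ([reduced_cone]). For generic points a and b, the polynomial f(a + t b)
    in t is separable ([separable_generic_line]): otherwise its derivative would
    be a zero divisor modulo it, and the change of variables x = a + t b would
    provide a w outside (f) such that f divides all the products of w by a
    partial derivative of f. This is impossible over a perfect field
    ([rdvd_of_rdvd_deriv]), since the annihilator of w modulo f would be a
    nonzero proper radical ideal stable under differentiation. The resultant of
    f(a + t b) and its t-derivative has degree at most d (d - 1) < q in a
    ([msize_resultant_leq]), so that a can be chosen rational ([meval_neq0]).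
    Exchanging the roles of the two points, which reverses the polynomial, the
    same argument provides a rational b ([exists_transverse_line]).

    Reducedness of the section. After a translation by t b, where g is not zero
    at b, the form g is a polynomial in t with invertible leading coefficient
    that is separable over the field of fractions, so that it generates a
    radical ideal ([reduced_of_separable_line]). Reducedness descends from the
    cone to all charts ([reduced_dehomog_ideal], [reduced_section]).

    Dimension of the section. Chains of primes are governed by iterated Krull
    boundaries ([iterated_boundary]). Choosing one element in each step of a
    chain of length l in a chart gives, together with the equations of the
    section and of the chart, l + 2 polynomials in r + 1 variables whose
    boundary does not contain 0; counting polynomials of bounded degree shows
    that l + 2 <= r + 1 ([boundary_mpoly0], [section_chain_leq]). Conversely,
    in a chart where g is not constant on the affine part of L, the r - 1
    remaining coordinates have a boundary that avoids the ideal of the section,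
    which yields a chain of length r - 1 ([section_chain_exists]). *)

Set Implicit Arguments.
Unset Strict Implicit.
Unset Printing Implicit Defensive.

Import GRing.Theory.

(** * Ideals and reduced quotients *)

Section Ideals.
Local Open Scope ring_scope.
Variable R : comNzRingType.

(** Ideals of a commutative ring, as predicates; the unit ideal is allowed. *)
Definition is_ideal (J : R -> Prop) : Prop :=
  [/\ J 0, forall a b, J a -> J b -> J (a + b) & forall c a, J a -> J (c * a)].

(** Divisibility in an arbitrary commutative ring: [rdvd a] is the principal
    ideal generated by [a]. *)
Definition rdvd (a b : R) : Prop := exists c, b = c * a.

Lemma ideal_rdvd a : is_ideal (rdvd a).
Proof.
split; first by exists 0; rewrite mul0r.
  by move=> _ _ [b ->] [c ->]; exists (b + c); rewrite mulrDl.
by move=> c _ [b ->]; exists (c * b); rewrite mulrA.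
Qed.

Lemma ideal_zero : is_ideal (fun a => a = 0).
Proof.
by split=> // [_ _ -> ->|c _ ->]; rewrite ?addr0 ?mulr0.
Qed.

Lemma ideal_ideal_gen (S : R -> Prop) : is_ideal (ideal_gen S).
Proof.
split; first by exists [::]; rewrite ?big_nil.
  move=> _ _ [s Ss ->] [t St ->]; exists (s ++ t); last by rewrite big_cat.
  by move=> cg; rewrite mem_cat => /orP[/Ss|/St].
move=> c _ [s Ss ->]; exists [seq (c * cg.1, cg.2) | cg <- s].
  by move=> _ /mapP[cg /Ss Scg ->].
by rewrite big_map mulr_sumr; apply: eq_bigr => cg _; rewrite mulrA.
Qed.

Lemma ideal_gen_mem (S : R -> Prop) p : S p -> ideal_gen S p.
Proof.
move=> Sp; exists [:: (1, p)]; last by rewrite big_seq1 mul1r.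
by move=> cg; rewrite inE => /eqP->.
Qed.

Lemma ideal_gen_min (S J : R -> Prop) :
  is_ideal J -> (forall p, S p -> J p) -> forall p, ideal_gen S p -> J p.
Proof.
move=> [J0 JD JM] SJ _ [s Ss ->].
rewrite big_seq; apply: (big_ind J) => // cg /Ss/SJ; exact: JM.
Qed.

Section Closure.
Variables (J : R -> Prop) (idJ : is_ideal J).

Lemma idealD a b : J a -> J b -> J (a + b).
Proof. by case: idJ => _ JD _; exact: JD. Qed.

Lemma idealM c a : J a -> J (c * a).
Proof. by case: idJ => _ _; exact. Qed.

Lemma idealN a : J a -> J (- a).
Proof. by rewrite -mulN1r; apply: idealM. Qed.

Lemma idealB a b : J a -> J b -> J (a - b).
Proof. by move=> Ja /idealN; apply: idealD. Qed.

Lemma ideal_sum (I : Type) (r : seq I) (P : pred I) (F : I -> R) :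
  (forall i, P i -> J (F i)) -> J (\sum_(i <- r | P i) F i).
Proof. by case: idJ => J0 JD _ JF; apply: (big_ind J). Qed.

Lemma ideal_congr a b : J (a - b) -> J b -> J a.
Proof. by move=> Jab /(idealD Jab); rewrite subrK. Qed.

Lemma ideal_subC a b : J (a - b) -> J (b - a).
Proof. by move/idealN; rewrite opprB. Qed.

Lemma ideal_congrM a b a' b' : J (a - a') -> J (b - b') -> J (a * b - a' * b').
Proof.
move=> Ja Jb; have -> : a * b - a' * b' = b * (a - a') + a' * (b - b') by ring.
by apply: idealD; apply: idealM.
Qed.

Lemma ideal_congrX a a' m : J (a - a') -> J (a ^+ m - a' ^+ m).
Proof.
move=> Ja; elim: m => [|m IHm]; first by rewrite !expr0 subrr; case: idJ.
by rewrite !exprS; apply: ideal_congrM.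
Qed.

End Closure.
End Ideals.

Section PolynomialMorphisms.
Local Open Scope ring_scope.
Variables (R S : comNzRingType) (n : nat) (J : S -> Prop).
Hypothesis idJ : is_ideal J.

(** Two ring morphisms out of a polynomial ring that agree modulo an ideal on
    constants and variables agree modulo that ideal everywhere. *)
Lemma mpoly_rmorph_congr (g h : {rmorphism {mpoly R[n]} -> S}) :
    (forall c, J (g c%:MP - h c%:MP)) -> (forall i, J (g 'X_i - h 'X_i)) ->
  forall p, J (g p - h p).
Proof.
move=> JC JX p; rewrite [p]mpolyE !rmorph_sum -sumrB.
apply: (ideal_sum idJ) => m _; rewrite -mul_mpolyC !rmorphM.
apply: (ideal_congrM idJ (JC _)).
rewrite mpolyXE_id !rmorph_prod.
apply: (big_ind2 (fun a b => J (a - b))) => [|a a' b b'|i _].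
- by rewrite subrr; case: idJ.
- exact: ideal_congrM.
- by rewrite !rmorphXn; apply: ideal_congrX.
Qed.
End PolynomialMorphisms.

Lemma mpoly_rmorph_eq (R S : comNzRingType) (n : nat)
    (g h : {rmorphism {mpoly R[n]} -> S}) :
    (forall c, g c%:MP_[n] = h c%:MP_[n])%R -> (forall i, g 'X_i = h 'X_i)%R ->
  g =1 h.
Proof.
move=> eC eX p; apply/eqP; rewrite -GRing.subr_eq0; apply/eqP.
by apply: (mpoly_rmorph_congr (ideal_zero S)) => [c|i]; rewrite ?eC ?eX GRing.subrr.
Qed.

Section RadicalExtension.
Local Open Scope ring_scope.

(** If R / J is reduced, so is (R / J)[t]: the leading coefficient of a
    nilpotent polynomial is nilpotent, hence can be discarded. *)
Lemma reduced_quotient_poly (R : idomainType) (J : R -> Prop) :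
    is_ideal J -> reduced_quotient J ->
  reduced_quotient (fun p : {poly R} => forall i, J p`_i).
Proof.
move=> idJ redJ p m Jpm.
have idJP : is_ideal (fun p : {poly R} => forall i, J p`_i).
  split=> [i|a b Ja Jb i|c a Ja i]; first by rewrite coef0; case: idJ.
    by rewrite coefD; apply: (idealD idJ).
  by rewrite coefM; apply: (ideal_sum idJ) => j _; apply: (idealM idJ).
have [k] := ubnP (size p); elim: k p Jpm => // k IHk p Jpm lek.
have [->|p0] := eqVneq p 0; first by case: idJP.
have Jc : J (lead_coef p).
  by apply: (redJ _ m); rewrite -lead_coef_exp; exact: Jpm.
pose q := lead_coef p *: 'X^((size p).-1).
have Jq : forall i, J q`_i by move=> i; rewrite coefZ mulrC; apply: (idealM idJ).
rewrite -(subrK q p); apply: (idealD idJP) => //; apply: IHk.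
  apply: (ideal_congr idJP _ Jpm); apply: (ideal_congrX idJP).
  by rewrite addrAC subrr add0r; apply: (idealN idJP).
apply: leq_trans (_ : size p <= k)%N; last by [].
rewrite -(prednK (_ : 0 < size p)%N) ?size_poly_gt0 // ltnS; apply/leq_sizeP => j.
rewrite leq_eqVlt => /orP[/eqP<-|ltj]; rewrite coefB coefZ coefXn.
  by rewrite eqxx mulr1 subrr.
by rewrite gtn_eqF // mulr0 subr0 nth_default // -(prednK (_ : 0 < size p)%N) ?size_poly_gt0.
Qed.

Lemma reduced_quotient_mpoly (R : comNzRingType) (n : nat) (J : R -> Prop) :
    is_ideal J -> reduced_quotient J ->
  reduced_quotient (fun p : {mpoly R[n]} => forall m, J p@_m).
Proof.
move=> idJ redJ p k Jpk.
have idJP : is_ideal (fun p : {mpoly R[n]} => forall m, J p@_m).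
  split=> [i|a b Ja Jb i|c a Ja i]; first by rewrite mcoeff0; case: idJ.
    by rewrite mcoeffD; apply: (idealD idJ).
  by rewrite mcoeffM; apply: (ideal_sum idJ) => j _; apply: (idealM idJ).
move: p Jpk; apply: mleadrect => p IHp Jpk.
have Jc : J (mleadc p) by apply: (redJ _ k); rewrite -mleadcX.
pose q := mleadc p *: 'X_[mlead p].
have Jq m : J q@_m by rewrite mcoeffZ mulrC; apply: (idealM idJ).
rewrite -(subrK q p); apply: (idealD idJP) => //.
have [->|r0] := eqVneq (p - q) 0; first by case: idJP.
have p0 : p != 0 by apply: contraNneq r0; rewrite /q => ->; rewrite mcoeff0 scale0r subrr.
apply: IHp; first exact: ltm_mleadD.
apply: (ideal_congr idJP _ Jpk); apply: (ideal_congrX idJP).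
by rewrite addrAC subrr add0r; apply: (idealN idJP).
Qed.

Lemma rdvd_polyC (R : comNzRingType) (a : R) (p : {poly R}) :
  rdvd a%:P p <-> forall i, rdvd a p`_i.
Proof.
split=> [[c ->] i|dvd]; first by exists c`_i; rewrite coefMC.
rewrite -[p]coefK poly_def; apply: (ideal_sum (ideal_rdvd _)) => i _.
by have [c ->] := dvd i; exists (c *: 'X^i); rewrite -!mul_polyC polyCM; ring.
Qed.

Lemma rdvd_mpolyC (R : comNzRingType) (n : nat) (a : R) (p : {mpoly R[n]}) :
  rdvd a%:MP p <-> forall m, rdvd a p@_m.
Proof.
split=> [[c ->] i|dvd]; first by exists c@_i; rewrite mulrC mcoeffCM mulrC.
rewrite [p]mpolyE; apply: (ideal_sum (ideal_rdvd _)) => m _.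
by have [c ->] := dvd m; exists (c *: 'X_[m]); rewrite -!mul_mpolyC mpolyCM; ring.
Qed.

End RadicalExtension.

(** * Hypersurfaces, their affine cones and their charts *)

Section Reversal.
Local Open Scope ring_scope.
Variable R : comNzRingType.

(** [rev_poly N p] is t^N p(1/t), for p of degree at most N. *)
Definition rev_poly (N : nat) (p : {poly R}) : {poly R} := \poly_(j < N.+1) p`_(N - j).

Lemma coef_rev N p j : (rev_poly N p)`_j = if (j <= N)%N then p`_(N - j) else 0.
Proof. by rewrite coef_poly ltnS. Qed.

Lemma rev_is_linear N : linear (rev_poly N).
Proof.
move=> c p q; apply/polyP=> j; rewrite coefD coefZ !coef_rev coefD coefZ.
by case: leqP; rewrite ?mulr0 ?addr0.
Qed.
HB.instance Definition _ N :=
  GRing.isLinear.Build R {poly R} {poly R} _ (rev_poly N) (rev_is_linear N).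

Lemma revXn N i : (i <= N)%N -> rev_poly N 'X^i = 'X^(N - i).
Proof.
move=> leiN; apply/polyP=> j; rewrite coef_rev !coefXn; case: leqP => [lejN|ltNj].
  by congr (_%:R); congr nat_of_bool; apply/eqP/eqP; lia.
by have /negbTE-> : j != (N - i)%N by lia.
Qed.

Lemma rev1 N : rev_poly N 1 = 'X^N.
Proof. by rewrite -[1](expr0 'X) revXn ?subn0. Qed.

Lemma revCM N c p : rev_poly N (c%:P * p) = c%:P * rev_poly N p.
Proof. by rewrite !mul_polyC linearZ. Qed.

Lemma revM N M (p q : {poly R}) : (size p <= N.+1)%N -> (size q <= M.+1)%N ->
  rev_poly (N + M) (p * q) = rev_poly N p * rev_poly M q.
Proof.
move=> leN leM; rewrite -[p]coefK -[q]coefK !poly_def big_distrl /= !linear_sum.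
rewrite big_distrl; apply: eq_bigr => i _; rewrite big_distrr linear_sum big_distrr.
apply: eq_bigr => j _.
have leiN : (i <= N)%N by rewrite -ltnS (leq_trans (ltn_ord i)).
have lejM : (j <= M)%N by rewrite -ltnS (leq_trans (ltn_ord j)).
have monoM (a b : R) k l : a *: 'X^k * (b *: 'X^l) = (a * b) *: 'X^(k + l).
  by rewrite -!mul_polyC exprD polyCM; ring.
rewrite !linearZ /= !revXn // !monoM linearZ /= revXn ?leq_add //.
by congr (_ *: 'X^_); lia.
Qed.

Lemma size_exp_bound N (p : {poly R}) m :
  (size p <= N.+1)%N -> (size (p ^+ m) <= (N * m).+1)%N.
Proof.
move=> leN; apply: leq_trans (size_poly_exp_leq _ _) _.
by rewrite ltnS leq_mul2r; apply/orP; right; lia.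
Qed.

Lemma revX N (p : {poly R}) m : (size p <= N.+1)%N -> rev_poly (N * m) (p ^+ m) = rev_poly N p ^+ m.
Proof.
move=> leN; elim: m => [|m IHm]; first by rewrite muln0 !expr0 rev1.
by rewrite !exprS mulnS revM ?IHm // size_exp_bound.
Qed.

(** Setting t = 1 / l in an identity V = g G + (l t - 1) H and clearing
    denominators shows that g divides a multiple of l^M V(1 / l). *)
Lemma rdvd_rev (g l : R) (V G H : {poly R}) (M : nat) :
    (size V <= M.+1)%N -> V = g%:P * G + H * (l%:P * 'X - 1) ->
  exists N, rdvd g (l ^+ N * (rev_poly M V).[l]).
Proof.
move=> leM defV; pose N := (size G + size H).+1; exists N.
pose K := (M + N).-1.
have EK : (M + N = K + 1)%N by rewrite /K /N; lia.
have: rev_poly (M + N) (V * 1) = rev_poly (M + N) V by rewrite mulr1.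
rewrite revM ?size_poly1 // rev1 {2}defV linearD /= revCM EK.
rewrite (revM (N := K)); first last.
- rewrite (leq_trans (size_polyD _ _)) // geq_max size_polyN size_poly1 andbT.
  by rewrite (leq_trans (size_polyMleq _ _)) // size_polyX addn2 /= size_polyC; case: eqP.
- by rewrite /K /N; lia.
have -> : rev_poly 1 (l%:P * 'X - 1) = l%:P - 'X.
  by rewrite linearB /= revCM rev1 expr1 -[X in rev_poly 1 X]expr1 revXn // subnn expr0 mulr1.
move=> /(congr1 (horner^~ l)); rewrite !hornerE subrr mulr0 addr0 mulrC => ->.
by exists (rev_poly (K + 1) G).[l]; rewrite mulrC.
Qed.

End Reversal.

Section Substitution.
Local Open Scope ring_scope.
Variables (R : comNzRingType) (n : nat).

(** Substitution of [c] for the variable of index [i]. *)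
Definition msubst (i : 'I_n) (c p : {mpoly R[n]}) : {mpoly R[n]} :=
  mmap (@mpolyC n R) (fun j => if j == i then c else 'X_j) p.
HB.instance Definition _ i c := GRing.RMorphism.copy (msubst i c)
  (mmap (@mpolyC n R) (fun j => if j == i then c else 'X_j)).

Lemma msubstC i c a : msubst i c a%:MP = a%:MP.
Proof. exact: mmapC. Qed.

Lemma msubstXU i c j : msubst i c 'X_j = if j == i then c else 'X_j.
Proof. by rewrite /msubst mmapX mmap1U. Qed.

Lemma msubst_congr i c p : rdvd ('X_i - c) (p - msubst i c p).
Proof.
apply: (mpoly_rmorph_congr (ideal_rdvd _) (g := idfun) (h := msubst i c)) => [a|j].
  by rewrite /= msubstC subrr; exists 0; rewrite mul0r.
rewrite /= msubstXU; case: eqVneq => [->|_]; first by exists 1; rewrite mul1r.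
by rewrite subrr; exists 0; rewrite mul0r.
Qed.

End Substitution.

Section CoprimeVariables.
Local Open Scope ring_scope.
Variables (R : idomainType) (n : nat).
Implicit Types (f c p : {mpoly R[n]}) (i j : 'I_n).

Lemma mpolyXU_neq0 i : 'X_i != 0 :> {mpoly R[n]}.
Proof. by rewrite -msize_poly_eq0 msizeX. Qed.

Lemma rdvd_XU i p : msubst i 0 p = 0 <-> rdvd 'X_i p.
Proof.
split=> [p0|[c ->]]; first by have := msubst_congr i 0 p; rewrite p0 !subr0.
by rewrite rmorphM /= msubstXU eqxx mulr0.
Qed.

Lemma rdvd_XU_Gauss i j N p : i != j -> rdvd 'X_i ('X_j ^+ N * p) -> rdvd 'X_i p.
Proof.
move=> neij /rdvd_XU; rewrite rmorphM rmorphXn /= msubstXU eq_sym (negbTE neij).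
move/eqP; rewrite mulf_eq0 expf_eq0 (negbTE (mpolyXU_neq0 _)) andbF /=.
by move/eqP/rdvd_XU.
Qed.

(** Distinct variables form a regular sequence: divisibility by f up to a power
    of each of them is divisibility by f. *)
Lemma rdvd_coprime_XU i j f c M N : i != j ->
  rdvd f ('X_i ^+ M * c) -> rdvd f ('X_j ^+ N * c) -> rdvd f c.
Proof.
move=> neij; elim: M => [|M IHM]; first by rewrite expr0 mul1r.
move=> [u Eu] [v Ev]; apply: IHM; last by exists v.
have [f0|f0] := eqVneq f 0.
  exists 0; rewrite f0 mulr0; apply/eqP; rewrite mulf_eq0 expf_eq0.
  rewrite (negbTE (mpolyXU_neq0 _)) andbF /=.
  by move/eqP: Eu; rewrite f0 mulr0 mulf_eq0 expf_eq0 (negbTE (mpolyXU_neq0 _)) andbF.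
have /rdvd_XU_Gauss : rdvd 'X_i ('X_j ^+ N * u).
  exists ('X_i ^+ M * v); apply: (mulIf f0).
  have -> : 'X_j ^+ N * u * f = 'X_j ^+ N * (u * f) by rewrite mulrA.
  rewrite -Eu exprS; have -> : 'X_i ^+ M * v * 'X_i * f = 'X_i * 'X_i ^+ M * (v * f) by ring.
  by rewrite -Ev; ring.
move=> /(_ neij)[w Ew]; exists w; apply: (mulfI (mpolyXU_neq0 i)).
by rewrite mulrA -exprS Eu Ew; ring.
Qed.

End CoprimeVariables.

Section Grading.
Local Open Scope ring_scope.
Variables (R : comNzRingType) (n : nat).
Implicit Types p : {mpoly R[n]}.

(** [grade p] is p(x_0 t, ..., x_n t), whose coefficient of t^e is the
    homogeneous component of degree e of p. *)
Definition grade p : {poly {mpoly R[n]}} :=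
  mmap (polyC \o @mpolyC n R) (fun i => ('X_i)%:P * 'X) p.
HB.instance Definition _ := GRing.RMorphism.copy grade
  (mmap (polyC \o @mpolyC n R) (fun i => ('X_i)%:P * 'X)).

Lemma gradeC c : grade c%:MP = c%:MP%:P.
Proof. exact: mmapC. Qed.

Lemma gradeX m : grade 'X_[m] = 'X_[m]%:P * 'X^(mdeg m).
Proof.
rewrite /grade mmapX /mmap1 mdegE mpolyXE_id rmorph_prod -prodrXr -big_split /=.
by apply: eq_bigr => i _; rewrite exprMn rmorphXn.
Qed.

Lemma gradeE p : grade p = \sum_(m <- msupp p) (p@_m *: 'X_[m])%:P * 'X^(mdeg m).
Proof.
rewrite {1}[p]mpolyE rmorph_sum; apply: eq_bigr => m _.
by rewrite -mul_mpolyC rmorphM /= gradeC gradeX polyCM mulrA.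
Qed.

Lemma grade_homog d p : p \is d.-homog -> grade p = p%:P * 'X^d.
Proof.
move=> /dhomogP hp; rewrite gradeE [X in _ = X%:P * _]mpolyE raddf_sum mulr_suml /=.
by apply: eq_big_seq => m /hp ->.
Qed.

Lemma coef_grade_homog p e : (grade p)`_e \is e.-homog.
Proof.
rewrite gradeE coef_sum rpred_sum // => m _.
rewrite coefCM coefXn; case: eqVneq => [->|_]; last by rewrite mulr0 rpred0.
by rewrite mulr1 rpredZ // dhomogX.
Qed.

Lemma grade1 p : (grade p).[1] = p.
Proof.
rewrite gradeE horner_sum [RHS]mpolyE; apply: eq_bigr => m _.
by rewrite !hornerE expr1n mulr1.
Qed.

End Grading.

Section Charts.
Local Open Scope ring_scope.
Variables (R : idomainType) (n : nat).
Implicit Types p g l : {mpoly R[n]}.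

(** The ideal (g, l - 1): the equation of the hypersurface g = 0 in the affine
    chart l = 1, when g and the linear form l are homogeneous. *)
Definition dehomog_ideal g l p : Prop := exists A B, p = A * g + B * (l - 1).

Lemma ideal_dehomog_ideal g l : is_ideal (dehomog_ideal g l).
Proof.
split; first by exists 0, 0; ring.
  by move=> _ _ [A [B ->]] [A' [B' ->]]; exists (A + A'), (B + B'); ring.
by move=> c _ [A [B ->]]; exists (c * A), (c * B); ring.
Qed.

Lemma grade_dehomog_ideal d g l A B : g \is d.-homog -> l \is 1.-homog ->
  grade (A * g + B * (l - 1)) =
    g%:P * (grade A * 'X^d) + grade B * (l%:P * 'X - 1).
Proof.
move=> hg hl; rewrite rmorphD; congr (_ + _).
  by rewrite rmorphM /= (grade_homog hg) mulrCA.
by rewrite rmorphM rmorphB rmorph1 /= (grade_homog hl) expr1.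
Qed.

(** A homogeneous p vanishing on the chart l = 1 of g = 0 is divisible by g up
    to a power of l. *)
Lemma dehomog_ideal_homog d e g l p : g \is d.-homog -> l \is 1.-homog -> p \is e.-homog ->
  dehomog_ideal g l p -> exists N, rdvd g (l ^+ N * p).
Proof.
move=> hg hl hp [A [B /(congr1 (@grade _ _))]].
rewrite (grade_dehomog_ideal _ _ hg hl) (grade_homog hp) => E.
have [] := @rdvd_rev _ g l (p%:P * 'X^e) (grade A * 'X^d) (grade B) e.
- rewrite (leq_trans (size_polyMleq _ _)) // size_polyXn size_polyC.
  by case: eqP => //= _; lia.
- exact: E.
by move=> N; rewrite revCM revXn // subnn expr0 mulr1 hornerC => H; exists N.
Qed.

(** If the affine cone g = 0 is reduced, so is its chart l = 1: a function p on
    the chart is homogenized with respect to l into the element q below. *)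
Lemma reduced_dehomog_ideal d g l : g \is d.-homog -> l \is 1.-homog ->
  reduced_quotient (rdvd g) -> reduced_quotient (dehomog_ideal g l).
Proof.
move=> hg hl redg p m [A [B /(congr1 (@grade _ _))]].
rewrite (grade_dehomog_ideal _ _ hg hl) rmorphXn /=; set M := size (grade p) => E.
have leM : (size (grade p) <= M.+1)%N by exact: leqnSn.
have [N] := rdvd_rev (size_exp_bound m leM) E.
rewrite revX // horner_exp; set q := (_).[l] => dvd.
have idg := ideal_rdvd g.
have /redg[c Ec] : rdvd g ((l * q) ^+ (N + m)).
  rewrite exprMn; have -> : l ^+ (N + m) * q ^+ (N + m) = (l ^+ m * q ^+ N) * (l ^+ N * q ^+ m).
    by rewrite !exprD; ring.
  exact: idealM.
have idJ := ideal_dehomog_ideal g l.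
have Jl : dehomog_ideal g l (l - 1) by exists 0, 1; ring.
apply: (ideal_congr idJ (b := l * q)); last by exists c, 0; rewrite Ec; ring.
apply: (ideal_subC idJ); rewrite -[p]mul1r; apply: (ideal_congrM idJ) => //.
rewrite -[X in _ - X]grade1 /q !horner_coef.
have -> : \sum_(i < size (rev_poly M (grade p))) (rev_poly M (grade p))`_i * l ^+ i =
   \sum_(i < M.+1) (grade p)`_(M - i) * l ^+ i.
  rewrite -horner_coef (horner_coef_wide _ (size_poly _ _)).
  by apply: eq_bigr => i _; rewrite coef_rev -ltnS ltn_ord.
have -> : \sum_(i < M) (grade p)`_i * 1 ^+ i = \sum_(i < M.+1) (grade p)`_(M - i) * 1 ^+ i.
  rewrite big_ord_recl /= subn0 nth_default // mul0r add0r; rewrite (reindex_inj rev_ord_inj) /=.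
  by apply: eq_bigr => i _; rewrite !expr1n.
rewrite -sumrB; apply: (ideal_sum idJ) => i _.
by rewrite -mulrBr; apply: (idealM idJ); apply: (ideal_congrX idJ).
Qed.

(** Conversely, if all standard charts of g = 0 are reduced, so is the cone:
    the homogeneous components of a nilpotent p vanish on every chart, and
    two charts are enough to conclude that g divides them. *)
Lemma reduced_cone d g (i j : 'I_n) : i != j -> g \is d.-homog ->
    (forall k, reduced_quotient (dehomog_ideal g 'X_k)) ->
  reduced_quotient (rdvd g).
Proof.
move=> neij hg red p m [c /(congr1 (@grade _ _))].
rewrite rmorphXn rmorphM /= (grade_homog hg) => E.
have coefP k e : dehomog_ideal g 'X_k (grade p)`_e.
  apply: (@reduced_quotient_poly _ _ (ideal_dehomog_ideal g 'X_k) (red k) _ m) => e'.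
  rewrite E mulrCA coefCM; exists (grade c * 'X^d)`_e', 0; ring.
have hX k : ('X_k : {mpoly R[n]}) \is 1.-homog by rewrite dhomogX; apply/eqP; exact: mdeg1.
have dvd e : rdvd g (grade p)`_e.
  have he := coef_grade_homog p e.
  have [M HM] := dehomog_ideal_homog hg (hX i) he (coefP i e).
  have [N HN] := dehomog_ideal_homog hg (hX j) he (coefP j e).
  exact: rdvd_coprime_XU neij HM HN.
rewrite -[p]grade1 horner_coef; apply: (ideal_sum (ideal_rdvd g)) => e _.
by rewrite mulrC; apply: (idealM (ideal_rdvd g)).
Qed.

End Charts.

(** * Derivatives of a reduced equation *)

Section DifferentialIdeals.
Local Open Scope ring_scope.

Lemma msize_leP (R : nzRingType) n (p : {mpoly R[n]}) k :
  (forall m, m \in msupp p -> (mdeg m < k)%N) -> (msize p <= k)%N.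
Proof.
by move=> lek; rewrite msizeE; apply/bigmax_leqP_seq => m /lek.
Qed.

Lemma msize_mderiv (R : nzRingType) n (p : {mpoly R[n]}) i :
  p != 0 -> (msize p^`M(i) < msize p)%N.
Proof.
move=> p0; rewrite [X in (_ < X)%N](mpolySpred _ p0) ltnS; apply: msize_leP => m.
rewrite mcoeff_msupp mcoeff_deriv => H.
have /msize_mdeg_lt : (m + U_(i))%MM \in msupp p.
  by rewrite mcoeff_msupp; apply: contraNneq H => ->; rewrite mul0rn.
by rewrite mdegD mdeg1; lia.
Qed.

Lemma mderivXU (R : nzRingType) n (i j : 'I_n) :
  ('X_i : {mpoly R[n]})^`M(j) = (i == j)%:R.
Proof.
rewrite mderivX mnm1E; case: eqVneq => [->|_]; last by rewrite scale0r.
have -> : (U_(j) - U_(j) = 0)%MM by apply/mnmP=> l; rewrite mnmBE mnm0E subnn.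
by rewrite mpolyX0 scale1r.
Qed.

(** Over a perfect field, a polynomial all of whose partial derivatives vanish
    is a p-th power. *)
Lemma pth_power_mpoly (k : finFieldType) n (h : {mpoly k[n]}) :
    (forall i, h^`M(i) = 0) -> (1 < msize h)%N ->
  exists2 g, (msize g < msize h)%N & exists2 p, (0 < p)%N & h = g ^+ p.
Proof.
move=> dh0 h1; have [p pr_p chp] := finPcharP k.
have p_gt1 := prime_gt1 pr_p.
have pdvd m i : m \in msupp h -> (p %| m i)%N.
  move=> hm; case Em : (m i) => [|e]; first exact: dvdn0.
  have := congr1 (mcoeff (m - U_(i))%MM) (dh0 i).
  have Um : (U_(i) <= m)%MM by rewrite lep1mP Em.
  rewrite mcoeff_deriv mcoeff0 submK // mnmBE mnm1E eqxx Em subn1 /= -mulr_natr.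
  by move/eqP; rewrite mulf_eq0 -(dvdn_pcharf chp) mcoeff_eq0 hm.
have [root _ rootK] : bijective (pFrobenius_aut chp) by apply/injF_bij/fmorph_inj.
have chpM : p \in [pchar {mpoly k[n]}].
  by rewrite inE pr_p /= -mpolyC_nat (pcharf0 chp) mpolyC0 eqxx.
pose divm (m : 'X_{1..n}) := [multinom (m i %/ p)%N | i < n].
have divmK m : m \in msupp h -> (divm m *+ p)%MM = m.
  by move=> hm; apply/mnmP=> i; rewrite mulmnE mnmE divnK // pdvd.
exists (\sum_(m <- msupp h) root h@_m *: 'X_[divm m]); last first.
  exists p; first exact: ltnW.
  rewrite -(pFrobenius_autE chpM) rmorph_sum {1}[h]mpolyE.
  apply: eq_big_seq => m hm; rewrite /= pFrobenius_autE exprZn mpolyXn divmK //.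
  by rewrite -{1}[h@_m]rootK pFrobenius_autE.
rewrite -(ltn_predK h1) ltnS; apply: msize_leP => m /msupp_sum_le.
case/flatten_mapP => m' /=; rewrite mem_filter => /andP[_ hm'] /msuppZ_le.
rewrite msuppX inE => /eqP->; rewrite -ltnS (ltn_predK h1).
have /(congr1 mdeg) := divmK _ hm'; rewrite mdegMn => E.
have := msize_mdeg_lt hm'; move: E h1 p_gt1.
by move: (mdeg (divm m')) (mdeg m') (msize h) => a b c <-; nia.
Qed.

(** The annihilator I of w modulo f is radical, and it is stable under the
    partial derivatives as soon as it contains those of f. A nonzero element
    of I of least degree then has zero derivatives, so that it is a constant,
    since otherwise it would be a p-th power, and its root an element of I
    of smaller degree. *)
Lemma rdvd_of_rdvd_deriv (k : finFieldType) n (f w : {mpoly k[n]}) :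
    f != 0 -> reduced_quotient (rdvd f) ->
  (forall i, rdvd f (w * f^`M(i))) -> rdvd f w.
Proof.
move=> f0 redf dvd_df; pose I h := rdvd f (h * w).
have idf := ideal_rdvd f.
have I_rad h p : (0 < p)%N -> I (h ^+ p) -> I h.
  move=> p_gt0 [c Ec]; apply: (redf _ p); exists (c * w ^+ p.-1).
  by rewrite exprMn -{2}(prednK p_gt0) exprS mulrA Ec; ring.
have I_deriv h i : I h -> I h^`M(i).
  move=> [c Ec]; apply: (redf _ 2); have [e Ee] := dvd_df i.
  have Ed : h^`M(i) * w = c^`M(i) * f + c * f^`M(i) - h * w^`M(i).
    by rewrite -mderivM -Ec mderivM; ring.
  (* w^2 times the derivative of h is in (f), hence so is the square of its
     product by w. *)
  exists (h^`M(i) * (w * c^`M(i) + c * e - w^`M(i) * c)).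
  rewrite expr2 mulrAC {1}Ed -!mulrA; transitivity (h^`M(i) * (w * c^`M(i) * f + c * (w * f^`M(i)) - w^`M(i) * (h * w))).
    by ring.
  by rewrite Ee Ec; ring.
have I1 : I 1.
  suff I_const h : h != 0 -> I h -> I 1.
    by apply: (I_const f) => //; exists w; rewrite mulrC.
  have [b] := ubnP (msize h); elim: b h => // b IHb h ltb h0 Ih.
  have [i di0|] := pickP (fun i => h^`M(i) != 0).
    apply: (IHb h^`M(i)) => //; last exact: I_deriv.
    by have := msize_mderiv i h0; move: ltb; lia.
  move=> /(_ _)/negbFE/eqP dh0.
  have [h1|] := leqP (msize h) 1.
    have Eh := msize1_polyC h1; have [c Ec] := Ih.
    have c0 : h@_0%MM != 0 by apply: contraNneq h0 => E; rewrite Eh E mpolyC0.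
    exists ((h@_0%MM)^-1%:MP * c).
    by rewrite -mulrA -Ec mulrA; congr (_ * w); rewrite [X in _ * X]Eh -mpolyCM mulVf.
  case/(pth_power_mpoly dh0) => g ltg [p p0 Eh].
  apply: (IHb g); first by move: ltg ltb; lia.
    by apply: contraNneq h0 => E; rewrite Eh E expr0n eqn0Ngt p0.
  by apply: (I_rad g p) => //; rewrite -Eh.
by move: I1; rewrite /I mul1r.
Qed.

(** If a linear form with indeterminate coefficients g_j annihilates W modulo a
    radical (f), so do all the g_j: differentiate with respect to the j-th
    variable and multiply by W. *)
Lemma rdvd_generic_derivation (R : comNzRingType) n (f : R) (g : 'I_n -> R) 
    (W : {mpoly R[n]}) : reduced_quotient (rdvd f) ->
  rdvd f%:MP (W * \sum_i 'X_i * (g i)%:MP) -> forall j, rdvd f%:MP (W * (g j)%:MP).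
Proof.
move=> redf; set G := \sum_i _ => -[c Ec] j.
have redF : reduced_quotient (rdvd f%:MP_[n]).
  move=> p m /rdvd_mpolyC dvd; apply/rdvd_mpolyC.
  exact: (reduced_quotient_mpoly (ideal_rdvd f) redf dvd).
have dG : G^`M(j) = (g j)%:MP.
  rewrite raddf_sum (bigD1 j) //= mderivM mderivC mulr0 addr0 mderivXU eqxx mul1r.
  by rewrite big1 ?addr0 // => i nij; rewrite mderivM mderivC mulr0 addr0 mderivXU (negbTE nij) mul0r.
apply: (redF _ 2).
have : W^`M(j) * G + W * (g j)%:MP = c^`M(j) * f%:MP.
  by rewrite -dG -mderivM Ec mderivM mderivC; ring.
move=> E; exists ((g j)%:MP * (W * c^`M(j) - W^`M(j) * c)).
rewrite -mulrA mulrBl -!mulrA -E -Ec; ring.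
Qed.

(** The derivative of f in the generic direction b is not a zero divisor modulo
    f, over k[x][b][t]. *)
Lemma rdvd_of_rdvd_generic_deriv (k : finFieldType) n (f : {mpoly k[n]})
    (W : {poly {mpoly {mpoly k[n]}[n]}}) :
    f != 0 -> reduced_quotient (rdvd f) ->
    rdvd f%:MP%:P (W * (\sum_i 'X_i * (f^`M(i))%:MP)%:P) ->
  rdvd f%:MP%:P W.
Proof.
move=> f0 redf /rdvd_polyC dvd; apply/rdvd_polyC => e; apply/rdvd_mpolyC => m.
apply: rdvd_of_rdvd_deriv => // i.
have := dvd e; rewrite coefMC => /(rdvd_generic_derivation redf)/(_ i)/rdvd_mpolyC/(_ m).
by rewrite mulrC mcoeffCM mulrC.
Qed.
End DifferentialIdeals.

(** * Rational points and restriction to lines *)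

Section Nonvanishing.
Local Open Scope ring_scope.

Lemma msize_sum_leq (R : nzRingType) n (I : Type) (r : seq I) (P : pred I)
    (F : I -> {mpoly R[n]}) k :
  (forall i, P i -> (msize (F i) <= k)%N) -> (msize (\sum_(i <- r | P i) F i) <= k)%N.
Proof.
move=> lek; apply: (big_ind (fun p => msize p <= k)%N) => //.
  by rewrite mmeasure0.
by move=> p q lep leq; rewrite (leq_trans (msizeD_le _ _)) // geq_max lep.
Qed.

Lemma msize_mul_leq (R : idomainType) n (p q : {mpoly R[n]}) a b :
  (msize p <= a.+1)%N -> (msize q <= b.+1)%N -> (msize (p * q) <= (a + b).+1)%N.
Proof.
have [->|p0] := eqVneq p 0; first by rewrite mul0r mmeasure0.
have [->|q0] := eqVneq q 0; first by rewrite mulr0 mmeasure0.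
by move=> lea leb; rewrite msizeM //; lia.
Qed.

Lemma msize_exp_leq (R : idomainType) n (p : {mpoly R[n]}) a m :
  (msize p <= a.+1)%N -> (msize (p ^+ m) <= (a * m).+1)%N.
Proof.
move=> lea; elim: m => [|m IHm]; first by rewrite expr0 msize1.
by rewrite exprS mulnS; apply: msize_mul_leq.
Qed.

Lemma msize_mmap_leq (R : idomainType) n (h : 'I_n -> {mpoly R[n]}) p :
  (forall i, (msize (h i) <= 2)%N) -> (msize (mmap (@mpolyC n R) h p) <= msize p)%N.
Proof.
move=> leh; rewrite /mmap big_seq; apply: msize_sum_leq => m /msize_mdeg_lt ltm.
rewrite mul_mpolyC (leq_trans (msizeZ_le _ _)) //; apply: leq_trans ltm.
rewrite /mmap1 mdegE; apply: (big_ind2 (fun p k => msize p <= k.+1)%N).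
- by rewrite msize1.
- by move=> ? ? ? ?; apply: msize_mul_leq.
- by move=> i _; rewrite -[X in (_ <= X.+1)%N]mul1n; apply: msize_exp_leq.
Qed.

Lemma msubst_neq0 (R : idomainType) n (E : seq R) (p : {mpoly R[n]}) i :
    uniq E -> p != 0 -> (msize p <= size E)%N ->
  exists2 c, c \in E & msubst i c%:MP p != 0.
Proof.
move=> uniqE p0 leE.
pose h (x : {poly {mpoly R[n]}}) (j : 'I_n) := if j == i then x else ('X_j)%:P.
pose u := mmap (polyC \o @mpolyC n R) (h 'X) p.
have uE c : u.[c] = msubst i c p.
  pose g := horner_eval c \o mmap (polyC \o @mpolyC n R) (h 'X).
  apply: (mpoly_rmorph_eq (g := g)) => [a|j] /=.
    by rewrite /horner_eval mmapC /= hornerC msubstC.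
  rewrite msubstXU /horner_eval mmapX mmap1U /h.
  by case: ifP => _; rewrite !hornerE.
have u0 : u != 0.
  apply: contraNneq p0 => u0; have := uE 'X_i; rewrite u0 horner0 => E0.
  apply/eqP; rewrite E0 -[LHS]/(idfun p).
  apply: (mpoly_rmorph_eq (g := idfun)) => [a|j] /=; first by rewrite msubstC.
  by rewrite msubstXU; case: eqP => [->|].
have [/hasP[c cE c0]|/hasPn all0] := boolP (has (fun c => msubst i c%:MP p != 0) E).
  by exists c.
have /(max_poly_roots u0) : all (root u) [seq c%:MP | c <- E].
  by apply/allP=> _ /mapP[c /all0/negbNE c0 ->]; rewrite rootE uE.
rewrite map_inj_uniq; last by move=> x y /eqP; rewrite mpolyC_eq => /eqP.
move=> /(_ uniqE); rewrite size_map ltnNge => /negP[].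
apply: leq_trans leE; rewrite /u /mmap big_seq.
apply: (big_ind (fun q : {poly {mpoly R[n]}} => size q <= msize p)%N) => [||m /msize_mdeg_lt ltm].
- by rewrite size_poly0.
- by move=> a b lea leb; rewrite (leq_trans (size_polyD _ _)) // geq_max lea.
rewrite /= mul_polyC (leq_trans (size_scale_leq _ _)) //; apply: leq_trans ltm.
rewrite /mmap1 mdegE; apply: (big_ind2 (fun (p : {poly {mpoly R[n]}}) k => size p <= k.+1)%N).
- by rewrite size_poly1.
- by move=> a k b l lea leb; rewrite (leq_trans (size_polyMleq _ _)) //; lia.
move=> j _; rewrite -[X in (_ <= X.+1)%N]mul1n size_exp_bound // /h.
by case: ifP => _; [rewrite size_polyX | rewrite (leq_trans (size_polyC_leq1 _))].
Qed.

(** Evaluation at [v] of the variables listed in [s]. *)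
Definition partial_eval (R : comNzRingType) n (s : seq 'I_n) (v : 'I_n -> R)
    (p : {mpoly R[n]}) : {mpoly R[n]} :=
  mmap (@mpolyC n R) (fun j => if j \in s then (v j)%:MP else 'X_j) p.
HB.instance Definition _ (R : comNzRingType) n s (v : 'I_n -> R) :=
  GRing.RMorphism.copy (partial_eval s v)
    (mmap (@mpolyC n R) (fun j => if j \in s then (v j)%:MP else 'X_j)).

Lemma partial_evalC (R : comNzRingType) n s (v : 'I_n -> R) c :
  partial_eval s v c%:MP = c%:MP.
Proof. exact: mmapC. Qed.

Lemma partial_evalXU (R : comNzRingType) n s (v : 'I_n -> R) j :
  partial_eval s v 'X_j = if j \in s then (v j)%:MP else 'X_j.
Proof. by rewrite /partial_eval mmapX mmap1U. Qed.

(** A nonzero polynomial of degree less than the size of E has a nonzero value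
    on E^n: the variables are specialized one at a time. *)
Lemma meval_neq0 (R : idomainType) n (E : seq R) (p : {mpoly R[n]}) :
    uniq E -> p != 0 -> (msize p <= size E)%N ->
  exists2 v, (forall i, v i \in E) & p.@[v] != 0.
Proof.
move=> uniqE p0 leE.
have [e eE] : exists e, e \in E.
  case: E leE {uniqE} => [|e E _]; last by exists e; rewrite inE eqxx.
  by rewrite leqn0 mmeasure_poly_eq0 (negbTE p0).
suff hsP s : exists2 v, (forall i, v i \in E) & partial_eval s v p != 0.
  have [v vE] := hsP (enum 'I_n).
  have -> : partial_eval (enum 'I_n) v p = (mpolyC n (R := R) \o meval v) p.
    apply: (mpoly_rmorph_eq (g := partial_eval _ _)) => [c|i] /=.
      by rewrite partial_evalC mevalC.
    by rewrite partial_evalXU mem_enum mevalXU.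
  by move=> vp; exists v; last by apply: contraNneq vp => /= ->; rewrite mpolyC0.
elim: s => [|i s [v vE IHs]].
  exists (fun _ => e); first by [].
  suff -> : partial_eval [::] (fun _ => e) p = p by [].
  apply: (mpoly_rmorph_eq (g := partial_eval _ _) (h := idfun)) => [c|i] /=.
    exact: partial_evalC.
  exact: partial_evalXU.
have [ins|nins] := boolP (i \in s).
  exists v; first by [].
  suff -> : partial_eval (i :: s) v p = partial_eval s v p by [].
  apply: (mpoly_rmorph_eq (g := partial_eval _ _) (h := partial_eval s v)) => [c|j] /=.
    by rewrite !partial_evalC.
  by rewrite !partial_evalXU inE; case: eqVneq => [->|_]; rewrite ?ins.
have [|c cE c0] := msubst_neq0 i uniqE IHs.
  apply: leq_trans leE; apply: msize_mmap_leq => j.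
  by case: ifP => _; rewrite ?msizeX ?mdeg1 // msizeC; case: eqP.
pose v' j := if j == i then c else v j.
exists v' => [j|]; first by rewrite /v'; case: ifP.
suff -> : partial_eval (i :: s) v' p = msubst i c%:MP (partial_eval s v p) by [].
apply: (mpoly_rmorph_eq (g := partial_eval _ _)
  (h := msubst i c%:MP \o partial_eval s v)) => [a|j] /=.
  by rewrite !partial_evalC msubstC.
rewrite !partial_evalXU inE /v'; case: eqVneq => [->|neji] /=.
  by rewrite (negbTE nins) msubstXU eqxx.
by case: ifP => _; rewrite ?msubstC // msubstXU (negbTE neji).
Qed.

End Nonvanishing.

Section Lines.
Local Open Scope ring_scope.
Variables (k : comNzRingType) (n : nat).

Section OneRing.
Variables (S : comNzRingType) (iota : {rmorphism k -> S}).
Implicit Types (f : {mpoly k[n]}) (a b : 'I_n -> S).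

(** The restriction f(a + t b) of f to the line through [a] with direction
    [b], as a univariate polynomial in t. *)
Definition line a b f : {poly S} :=
  mmap (polyC \o iota) (fun i => (a i)%:P + b i *: 'X) f.
HB.instance Definition _ a b := GRing.RMorphism.copy (line a b)
  (mmap (polyC \o iota) (fun i => (a i)%:P + b i *: 'X)).

Lemma lineC a b c : line a b c%:MP = (iota c)%:P.
Proof. by rewrite /line mmapC. Qed.

Lemma lineXU a b i : line a b 'X_i = (a i)%:P + b i *: 'X.
Proof. by rewrite /line mmapX mmap1U. Qed.

Lemma line_eq a b a' b' f : a =1 a' -> b =1 b' -> line a b f = line a' b' f.
Proof.
move=> Ea Eb; apply: mpoly_rmorph_eq => [c|i] /=; first by rewrite !lineC.
by rewrite !lineXU Ea Eb.
Qed.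

Lemma horner_line a b f c : (line a b f).[c] = mmap iota (fun i => a i + b i * c) f.
Proof.
apply: (mpoly_rmorph_eq (g := horner_eval c \o line a b)) => [e|i] /=.
  by rewrite /horner_eval lineC hornerC mmapC.
by rewrite /horner_eval lineXU mmapX mmap1U !hornerE.
Qed.

Lemma line_comp a b f c e :
  line a b f \Po (c%:P + e *: 'X) =
    line (fun i => a i + b i * c) (fun i => b i * e) f.
Proof.
apply: (mpoly_rmorph_eq (g := comp_poly (c%:P + e *: 'X) \o line a b)) => [u|i] /=.
  by rewrite !lineC comp_polyC.
rewrite !lineXU comp_polyD comp_polyZ comp_polyC comp_polyX scalerDr scalerA polyCD.
by rewrite addrA; congr (_ + _ + _); rewrite -mul_polyC polyCM.
Qed.

Lemma deriv_line a b f :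
  (line a b f)^`() = \sum_i b i *: line a b (f^`M(i)).
Proof.
elim/mpolyind: f => [|c m p _ _ IHp].
  by rewrite rmorph0 deriv0 big1 // => i _; rewrite mderiv0 rmorph0 scaler0.
rewrite rmorphD derivD IHp; under [RHS]eq_bigr do rewrite mderivD rmorphD scalerDr.
rewrite big_split; congr (_ + _) => {IHp p}.
under [RHS]eq_bigr => i _ do rewrite -mul_mpolyC mderiv_mulC rmorphM /= lineC mul_polyC scalerA mulrC -scalerA.
rewrite -mul_mpolyC rmorphM /= lineC mul_polyC derivZ -scaler_sumr; congr (_ *: _).
have derivM_closed p q :
    (line a b p)^`() = \sum_i b i *: line a b (p^`M(i)) ->
    (line a b q)^`() = \sum_i b i *: line a b (q^`M(i)) ->
  (line a b (p * q))^`() = \sum_i b i *: line a b ((p * q)^`M(i)).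
  move=> Ep Eq; rewrite rmorphM derivM Ep Eq mulr_suml mulr_sumr -big_split /=.
  apply: eq_bigr => i _; rewrite mderivM rmorphD !rmorphM scalerDr.
  by rewrite scalerAl scalerAr.
have deriv1 : (line a b 1)^`() = \sum_i b i *: line a b (1^`M(i)).
  by rewrite rmorph1 derivC big1 // => i _; rewrite -mpolyC1 mderivC rmorph0 scaler0.
rewrite mpolyXE_id.
apply: (big_ind (fun p => (line a b p)^`() = \sum_i b i *: line a b (p^`M(i)))) => //.
move=> j _; elim: (m j) => [|e IHe]; first by rewrite expr0.
rewrite exprS; apply: derivM_closed => //.
rewrite lineXU derivD derivC add0r derivZ derivX (bigD1 j) //= mderivXU eqxx rmorph1.
by rewrite big1 ?addr0 // => i nij; rewrite mderivXU eq_sym (negbTE nij) rmorph0 scaler0.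
Qed.

Lemma size_line d a b f : f \is d.-homog -> (size (line a b f) <= d.+1)%N.
Proof.
move=> /dhomogP hf; rewrite /line /mmap big_seq.
apply: (big_ind (fun p : {poly S} => size p <= d.+1)%N) => [||m /hf Em].
- by rewrite size_poly0.
- by move=> p q lep leq; rewrite (leq_trans (size_polyD _ _)) // geq_max lep.
rewrite /= mul_polyC (leq_trans (size_scale_leq _ _)) // -(Em : mdeg m = d).
rewrite /mmap1 mdegE; apply: (big_ind2 (fun (p : {poly S}) k => size p <= k.+1)%N).
- by rewrite size_poly1.
- by move=> p u q l lea leb; rewrite (leq_trans (size_polyMleq _ _)) //; lia.
move=> j _; rewrite -[X in (_ <= X.+1)%N]mul1n size_exp_bound //.
rewrite (leq_trans (size_polyD _ _)) // geq_max (leq_trans (size_polyC_leq1 _)) //.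
by rewrite (leq_trans (size_scale_leq _ _)) // size_polyX.
Qed.

(** Exchanging the two points that span the line reverses the polynomial. *)
Lemma rev_line d a b f : f \is d.-homog -> rev_poly d (line a b f) = line b a f.
Proof.
move=> /dhomogP hf; rewrite /line /mmap linear_sum; apply: eq_big_seq => m /hf Em.
rewrite /= revCM; congr (_ * _); rewrite -(Em : mdeg m = d) /mmap1 mdegE.
have size1 (i : 'I_n) : (size ((a i)%:P + b i *: 'X : {poly S})%R <= 2)%N.
  rewrite (leq_trans (size_polyD _ _)) // geq_max (leq_trans (size_polyC_leq1 _)) //.
  by rewrite (leq_trans (size_scale_leq _ _)) // size_polyX.
have rev_i (i : 'I_n) : rev_poly 1 ((a i)%:P + b i *: 'X) = (b i)%:P + a i *: 'X.
  rewrite linearD linearZ /= -[(a i)%:P]mulr1 revCM rev1 -[X in rev_poly 1 X]expr1 revXn //.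
  by rewrite expr1 expr0 mul_polyC addrC alg_polyC.
pose Q (N : nat) (p q : {poly S}) := (size p <= N.+1)%N /\ rev_poly N p = q.
suff : Q (\sum_i m i)%N (\prod_i ((a i)%:P + b i *: 'X) ^+ m i)
  (\prod_i ((b i)%:P + a i *: 'X) ^+ m i) by case.
apply: (big_ind3 Q).
- by split; rewrite ?size_poly1 // rev1 expr0.
- move=> N1 p1 q1 N2 p2 q2 [s1 <-] [s2 <-]; split; last by rewrite revM.
  by rewrite (leq_trans (size_polyMleq _ _)) //; lia.
move=> i _; rewrite -[X in Q X]mul1n; split; first exact: size_exp_bound.
by rewrite revX // rev_i.
Qed.

Lemma coef_line_homog d a b f : f \is d.-homog -> (line a b f)`_d = mmap iota b f.
Proof.
move=> hf; have := coef_rev d (line a b f) 0.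
rewrite leq0n subn0 => <-; rewrite (rev_line _ _ hf) -horner_coef0 horner_line.
apply: (mpoly_rmorph_eq (g := mmap iota _) (h := mmap iota _)) => [c|i] /=; first by rewrite !mmapC.
by rewrite !mmapX !mmap1U mulr0 addr0.
Qed.

End OneRing.

Lemma map_line (S S' : comNzRingType) (iota : {rmorphism k -> S})
    (phi : {rmorphism S -> S'}) (iota' : {rmorphism k -> S'}) a b a' b' f :
    (forall c, phi (iota c) = iota' c) ->
    (forall i, phi (a i) = a' i) -> (forall i, phi (b i) = b' i) ->
  map_poly phi (line iota a b f) = line iota' a' b' f.
Proof.
move=> Ei Ea Eb.
apply: (mpoly_rmorph_eq (g := map_poly phi \o line iota a b)) => [c|i] /=.
  by rewrite !lineC map_polyC /= Ei.
by rewrite !lineXU rmorphD /= map_polyC map_polyZ map_polyX /= Ea Eb.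
Qed.

End Lines.

(** * Degree of a resultant *)

Section Weights.
Local Open Scope ring_scope.
Variables (R : idomainType) (n : nat).
Implicit Types (P Q : {poly {mpoly R[n]}}).

(** [P] has weight at most [w] when the coefficient of t^j has degree at most
    w - j; for j > w the truncated subtraction forces it to be zero. *)
Definition wt_le w P : Prop := forall j, (msize P`_j <= w.+1 - j)%N.

Lemma wt_le_sum w (I : Type) (r : seq I) (X : pred I) (F : I -> {poly {mpoly R[n]}}) :
  (forall i, X i -> wt_le w (F i)) -> wt_le w (\sum_(i <- r | X i) F i).
Proof. by move=> leF j; rewrite coef_sum; apply: msize_sum_leq => i /leF. Qed.

Lemma wt_leM v w P Q : wt_le v P -> wt_le w Q -> wt_le (v + w) (P * Q).
Proof.
move=> leP leQ j; rewrite coefM; apply: msize_sum_leq => i _.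
have [->|p0] := eqVneq P`_i 0; first by rewrite mul0r mmeasure0.
have [->|q0] := eqVneq Q`_(j - i) 0; first by rewrite mulr0 mmeasure0.
have := leP i; have := leQ (j - i)%N; rewrite msizeM // (mpolySpred _ p0) (mpolySpred _ q0).
by have := ltn_ord i; lia.
Qed.

Lemma wt_le1 : wt_le 0 1.
Proof. by case=> [|j]; rewrite coef1 ?msize1 ?mmeasure0. Qed.

Lemma wt_leX w P m : wt_le w P -> wt_le (w * m) (P ^+ m).
Proof.
move=> leP; elim: m => [|m IHm]; first by rewrite expr0 muln0; apply: wt_le1.
by rewrite exprS mulnS; apply: wt_leM.
Qed.

Lemma wt_le_deriv w P : wt_le w.+1 P -> wt_le w P^`().
Proof.
move=> leP j; rewrite coef_deriv -mulr_natr -mpolyC_nat mulrC mul_mpolyC.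
exact: leq_trans (msizeZ_le _ _) (leP _).
Qed.

Lemma wt_le_line (k : comNzRingType) (iota : {rmorphism k -> {mpoly R[n]}}) d
    (v : 'I_n -> R) f :
  (forall c, msize (iota c) <= 1)%N -> f \is d.-homog ->
  wt_le d (line iota (fun i => 'X_i) (fun i => (v i)%:MP) f).
Proof.
move=> size_iota /dhomogP hf; rewrite /line /mmap big_seq; apply: wt_le_sum => m /hf Em.
rewrite -[d]add0n; apply: wt_leM.
  by case=> [|j]; rewrite /= coefC /= ?mmeasure0 // size_iota.
rewrite -(Em : mdeg m = d) mdegE /mmap1.
apply: (big_ind2 (fun P w => wt_le w P)) => [||i _].
- exact: wt_le1.
- by move=> ? ? ? ?; apply: wt_leM.
rewrite -[X in wt_le X]mul1n; apply: wt_leX => -[|[|j]].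
- by rewrite coefD coefZ coefX coefC mulr0 addr0 msizeX mdeg1.
- by rewrite coefD coefZ coefX coefC mulr1 add0r msizeC; case: eqP.
- by rewrite coefD coefZ coefX coefC mulr0 add0r mmeasure0.
Qed.

(** Isobaric bound on the degree of a resultant, read off Leibniz's formula
    for the Sylvester determinant. The sizes are those of P and Q, which may
    be smaller than what the weights allow. *)
Lemma msize_resultant_leq v w P Q :
  wt_le v P -> wt_le w Q ->
  (msize (resultant P Q) <=
     ((size Q).-1 * v + (size P).-1 * w - (size Q).-1 * (size P).-1).+1)%N.
Proof.
move=> leP leQ; set e := (size Q).-1; set d := (size P).-1.
apply: msize_sum_leq => s _; rewrite mulr_sign.
set T := \prod_i _; suff : T = 0 \/ (msize T + e * d <= (e * v + d * w).+1)%N.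
  by case=> [->|leT]; case: ifP => _; rewrite ?oppr0 ?mmeasure0 ?mmeasureN //; lia.
pose wrow (i : 'I_(e + d)) := match split i with inl r => (v + r)%N | inr r => (w + r)%N end.
pose X (p : {mpoly R[n]}) (j u : nat) := p = 0 \/ (msize p + j <= u.+1)%N.
have : X T (\sum_i (s i : 'I_(e + d)))%N (\sum_i wrow i)%N.
  apply: (big_ind3 X) => [|p1 j1 u1 p2 j2 u2 |i _].
  - by right; rewrite msize1.
  - case=> [->|le1]; first by left; rewrite mul0r.
    case=> [->|le2]; first by left; rewrite mulr0.
    have [->|p10] := eqVneq p1 0; first by left; rewrite mul0r.
    have [->|p20] := eqVneq p2 0; first by left; rewrite mulr0.
    right; rewrite msizeM //; move: le1 le2.
    by rewrite (mpolySpred _ p10) (mpolySpred _ p20); lia.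
  have arith (x y z u : nat) : (z <= y)%N -> (x <= u.+1 - (y - z))%N -> (0 < x)%N ->
      (x + y <= (u + z).+1)%N by lia.
  rewrite Sylvester_mxE /wrow /X; case: (split i) => r.
    case: leqP => [ler|]; last by left; rewrite mulr0n.
    rewrite mulr1n; have [->|p0] := eqVneq P`_(s i - r) 0; [by left|right].
    by apply: arith ler (leP _) _; rewrite lt0n mmeasure_poly_eq0.
  case: leqP => [ler|]; last by left; rewrite mulr0n.
  rewrite mulr1n; have [->|p0] := eqVneq Q`_(s i - r) 0; [by left|right].
  by apply: arith ler (leQ _) _; rewrite lt0n mmeasure_poly_eq0.
case=> [->|leT]; [by left|right]; move: leT.
have -> : (\sum_i (s i : 'I_(e + d)) = \sum_(i < e + d) i)%N.
  by rewrite [RHS](reindex_inj (@perm_inj _ s)).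
rewrite !big_split_ord /=.
have -> : (\sum_(i < e) wrow (lshift d i) = e * v + \sum_(i < e) i)%N.
  rewrite -[X in (X * v)%N]card_ord -sum_nat_const -big_split; apply: eq_bigr => i _.
  by rewrite /wrow (unsplitK (inl _ i)).
have -> : (\sum_(i < d) wrow (rshift e i) = d * w + \sum_(i < d) i)%N.
  rewrite -[X in (X * w)%N]card_ord -sum_nat_const -big_split; apply: eq_bigr => i _.
  by rewrite /wrow (unsplitK (inr _ i)).
have -> : (\sum_(i < d) (e + i) = d * e + \sum_(i < d) i)%N.
  by rewrite -[X in (X * e)%N]card_ord -sum_nat_const -big_split.
have arith (m a b c x y : nat) :
  (m + (x + (c + y)) <= (a + x + (b + y)).+1 -> m + c <= (a + b).+1)%N by lia.
by rewrite [(d * e)%N]mulnC; apply: arith.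
Qed.
End Weights.

(** * Separable polynomials *)

Section Separability.
Local Open Scope ring_scope.

Lemma separableE (R : idomainType) (p : {poly R}) :
  separable_poly p = coprimep p p^`().
Proof. by rewrite unlock. Qed.

(** A resultant is in the ideal generated by the two polynomials, including
    when the second one is constant. *)
Lemma resultant_ideal (R : comNzRingType) (p q : {poly R}) : (1 < size p)%N ->
  exists U V, (resultant p q)%:P = U * p + V * q.
Proof.
move=> p1; have [q1|q1] := leqP (size q) 1; last first.
  by have [[U V] _ ->] := resultant_in_ideal p1 q1; exists U, V.
have Eq := size1_polyC q1; set c := q`_0 in Eq.
have qE j : q`_j = c * (j == 0%N)%:R by rewrite [in LHS]Eq coefC; case: eqP; rewrite ?mulr1 ?mulr0.
have -> : resultant p q = c ^+ ((size q).-1 + (size p).-1) *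
    \det (\matrix_(i < (size q).-1 + (size p).-1, j < (size q).-1 + (size p).-1)
      (if split i is inr k then ((k <= j) && (j - k == 0))%N%:R else 0)).
  rewrite -detZ; congr (\det _); apply/matrixP=> i j.
  rewrite Sylvester_mxE !mxE; case: (split i) => k; last first.
    by rewrite qE; case: leqP => _; rewrite ?mulr1n ?mulr0n ?mulr0.
  suff : (k < 0)%N by [].
  by apply: leq_trans (ltn_ord k) _; rewrite -subn1 leq_subLR.
set D := \det _; set m := (_ + _)%N; have m0 : (0 < m)%N by rewrite /m; lia.
exists 0, (c ^+ m.-1 * D)%:P; rewrite mul0r add0r Eq -polyCM.
by rewrite -{1}(prednK m0) exprSr; congr (_%:P); ring.
Qed.

(** A specialization that does not kill the resultant of p and p' keeps p
    separable, even if it lowers the degree of p'. *)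
Lemma separable_of_resultant (R S : idomainType) (phi : {rmorphism R -> S})
    (p : {poly R}) : (1 < size p)%N ->
  phi (resultant p p^`()) != 0 -> separable_poly (map_poly phi p).
Proof.
move=> p1 phiD; rewrite separableE; apply/Bezout_coprimepP.
have [U [V /(congr1 (map_poly phi))]] := resultant_ideal p^`() p1.
rewrite map_polyC rmorphD !rmorphM /= -deriv_map => E.
by exists (map_poly phi U, map_poly phi V); rewrite /= -E polyC_eqp1.
Qed.

Lemma separable_resultant (R : idomainType) (p : {poly R}) : p != 0 ->
  separable_poly p = (resultant p p^`() != 0).
Proof.
move=> p0; rewrite separableE /coprimep resultant_eq0 -leqNgt.
have : (0 < size (gcdp p p^`()))%N by rewrite size_poly_gt0 gcdp_eq0 negb_and p0.
by case: (size _) => [|[|m]].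
Qed.

Lemma separable_coef01 (R : idomainType) (p : {poly R}) :
  separable_poly p -> (p`_0 != 0) || (p`_1 != 0).
Proof.
rewrite separableE -negb_and => cop; apply/andP => -[/eqP p0 /eqP p1].
have rp : root p 0 by rewrite rootE horner_coef0 p0.
by have := coprimep_root cop rp; rewrite horner_coef0 coef_deriv p1 mul0rn eqxx.
Qed.

(** A binary form of degree d without multiple roots on the projective line
    stays so after exchange of 0 and infinity; the lower bound on the size of
    p says that infinity is at most a simple root. *)
Lemma separable_rev (R : idomainType) d (p : {poly R}) :
  (d <= size p <= d.+1)%N -> (0 < d)%N -> separable_poly p -> separable_poly (rev_poly d p).
Proof.
move=> /andP[led leS] d0; rewrite !separableE => /Bezout_coprimepP[[u v] /= E].
set q := rev_poly d p; set g := gcdp q q^`().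
have gq : g %| q := dvdp_gcdl _ _.
have gq' : g %| q^`() := dvdp_gcdr _ _.
have Er : rev_poly d ('X * p^`()) = d%:R *: q - 'X * q^`().
  apply/polyP=> j; rewrite coefB coefZ coef_rev !coefXM !coef_deriv !coef_rev mulr_natl.
  case: j => [|j] /=.
    by rewrite !subn0 subr0 (gtn_eqF d0) (prednK d0).
  case: (ltnP j d) => ltj; last by rewrite !mul0rn subr0.
  case: eqP => [/eqP|Hj].
    rewrite subn_eq0 => ledj; have -> : d = j.+1 by lia.
    by rewrite subrr.
  by rewrite prednK ?lt0n; [rewrite -mulrnBr //; congr (_ *+ _); lia | apply/eqP].
have gr : g %| rev_poly d ('X * p^`()).
  by rewrite Er dvdp_sub ?dvdp_mull // -mul_polyC dvdp_mull.
have [c c0 Ec] : exists2 c, c != 0 & u * p + v * p^`() = c%:P.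
  have := E; rewrite -size_poly_eq1 => /size_poly1P[c c0 ->]; by exists c.
pose N := (size u + size v).+1.
have sdp : (size p^`() <= d)%N.
  by apply: leq_trans (size_poly _ _) _; rewrite -subn1 leq_subLR.
(* The reversed Bezout identity shows that a common factor of q and q' is a
   power of t, and t is not one since p has degree at least d - 1. *)
have gX : g %| 'X^((N + d).-1).
  have : g %| rev_poly (N + d) (u * 'X * p + v * ('X * p^`())).
    have s1 : (size (u * 'X)%R <= N.+1)%N.
      by rewrite (leq_trans (size_polyMleq _ _)) // size_polyX /N; lia.
    have s2 : (size v <= N.+1)%N by rewrite /N; lia.
    have s3 : (size ('X * p^`())%R <= d.+1)%N.
      by rewrite (leq_trans (size_polyMleq _ _)) // size_polyX.
    by rewrite linearD /= (revM s1 leS) (revM s2 s3) dvdp_add ?dvdp_mull.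
  have -> : u * 'X * p + v * ('X * p^`()) = c%:P * 'X^1.
    by rewrite -Ec expr1; ring.
  by rewrite revCM revXn ?mul_polyC ?dvdpZr ?subn1 // addn_gt0 d0 orbT.
have gX0 : coprimep g 'X.
  rewrite coprimepX; apply/negP => g0.
  have /eqP := root_dvdp gq g0; have /eqP := root_dvdp gq' g0.
  rewrite !horner_coef0 coef_deriv !coef_rev d0 leq0n subn0 mulr1n subn1 => p1 p2.
  have : (size p <= d.-1)%N.
    apply/leq_sizeP => j; rewrite leq_eqVlt => /orP[/eqP<- //|].
    rewrite prednK // leq_eqVlt => /orP[/eqP<- //|ltj].
    by rewrite nth_default // (leq_trans leS).
  by lia.
by have := coprimep_dvdl gX (coprimep_expr _ gX0); rewrite coprimepp.
Qed.

Lemma size_rev_separable (R : idomainType) d (p : {poly R}) :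
  (0 < d)%N -> separable_poly p -> (d <= size (rev_poly d p) <= d.+1)%N.
Proof.
move=> d0 sep_p; rewrite [X in _ && X]size_poly andbT.
have /orP[p0|p1] := separable_coef01 sep_p.
  apply: ltnW; rewrite ltnNge; apply: contra p0 => leQ.
  by have := coef_rev d p d; rewrite leqnn subnn nth_default // => <-.
rewrite leqNgt; apply: contra p1 => ltQ.
have := coef_rev d p d.-1; rewrite leq_pred nth_default; last by rewrite -ltnS prednK.
by rewrite -subn1 subKn // => <-.
Qed.

End Separability.

(** * The generic line *)

(** Separability as regularity of the derivative: if g is the gcd of p and p',
    the cofactor p / g annihilates p' modulo p. *)
Lemma separable_of_rdvd (R : idomainType) (p : {poly R}) : (p != 0 ->
    (forall W, rdvd p (W * p^`()) -> rdvd p W) -> separable_poly p)%R.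
Proof.
move=> p0 p_reg; rewrite separableE; apply: contraT => ncop; set g := gcdp p p^`().
have g1 : (1 < size g)%N.
  have : (0 < size g)%N by rewrite size_poly_gt0 gcdp_eq0 negb_and p0.
  by move: ncop; rewrite /coprimep -/g; case: (size g) => [|[|m]].
have := Pdiv.Idomain.divpKC (dvdp_gcdl p p^`()); rewrite -/g; set w := (_ %/ _)%R.
set c := (lead_coef g ^+ _)%R => Ew.
have := Pdiv.Idomain.divpKC (dvdp_gcdr p p^`()); rewrite -/g; set v := (_ %/ _)%R.
set c' := (lead_coef g ^+ _)%R => Ev.
have g0 : g != 0%R by rewrite -size_poly_gt0 ltnW.
have c0 : c != 0%R by rewrite expf_neq0 // lead_coef_eq0.
have c'0 : c' != 0%R by rewrite expf_neq0 // lead_coef_eq0.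
have gw0 : (g * w)%R != 0%R by rewrite Ew -mul_polyC mulf_eq0 polyC_eq0 negb_or c0.
have w0 : w != 0%R by apply: contraNneq gw0 => ->; rewrite mulr0.
have [u Eu] : rdvd p (c' *: w)%R.
  apply: p_reg; exists (c *: v)%R; transitivity (w * (c' *: p^`()))%R.
    by rewrite -!mul_polyC; ring.
  rewrite -Ev; transitivity (v * (g * w))%R; first by ring.
  by rewrite Ew -!mul_polyC; ring.
have : size w < size p.
  have : size (g * w)%R = size p by rewrite Ew size_scale.
  rewrite size_mul //; move: g1 (size_poly_gt0 w); rewrite w0.
  by move: (size g) (size w) (size p) => x y z; lia.
have u0 : u != 0%R.
  by apply: contraNneq w0 => u0; move/eqP: Eu; rewrite u0 mul0r -mul_polyC mulf_eq0 polyC_eq0 (negbTE c'0).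
rewrite ltnNge -(size_scale w c'0) Eu size_mul // => /negP[].
have : 0 < size u by rewrite size_poly_gt0.
by move: (size u) (size p) => x y; lia.
Qed.

Section Assignment.
Local Open Scope ring_scope.
Variables (A T : comNzRingType) (n : nat).
Implicit Types (g : {rmorphism A -> T}) (be : 'I_n -> T) (tau : T).

(** The morphism from A[y_1, ..., y_n][t] that extends [g], with values [be]
    on the y_i and [tau] on t. *)
Definition assign g be tau (W : {poly {mpoly A[n]}}) : T :=
  (map_poly (mmap g be) W).[tau].
HB.instance Definition _ g be tau := GRing.RMorphism.copy (assign g be tau)
  (horner_eval tau \o map_poly (mmap g be)).

Lemma assignX g be tau : assign g be tau 'X = tau.
Proof. by rewrite /assign map_polyX hornerX. Qed.

Lemma assignXU g be tau i : assign g be tau ('X_i)%:P = be i.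
Proof. by rewrite /assign map_polyC hornerC /= mmapX mmap1U. Qed.

Lemma assignC g be tau a : assign g be tau a%:MP%:P = g a.
Proof. by rewrite /assign map_polyC hornerC /= mmapC. Qed.

Lemma assign_ext (g h : {rmorphism {poly {mpoly A[n]}} -> T}) :
    (forall a, g a%:MP%:P = h a%:MP%:P) -> (forall i, g ('X_i)%:P = h ('X_i)%:P) ->
  g 'X = h 'X -> g =1 h.
Proof.
move=> EC EU EX W; rewrite -[W]coefK poly_def !rmorph_sum; apply: eq_bigr => i _.
rewrite -mul_polyC !rmorphM !rmorphXn EX; congr (_ * _).
exact: (mpoly_rmorph_eq (g := g \o polyC) (h := h \o polyC)).
Qed.
End Assignment.

(** The ring [A] is an isomorphic copy of k[b_1, ..., b_n]; keeping it abstract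
    separates its domain structure from the nested polynomial rings. *)
Section GenericLine.
Local Open Scope ring_scope.
Variables (k : finFieldType) (n : nat) (A : idomainType).
Variables (u : {rmorphism {mpoly k[n]} -> A}) (u' : {rmorphism A -> {mpoly k[n]}}).
Hypotheses (uK : cancel u u') (u'K : cancel u' u).
Local Notation C := {poly {mpoly {mpoly k[n]}[n]}}.
Local Notation P := {poly {mpoly A[n]}}.

Definition generic_iota : {rmorphism k -> {mpoly A[n]}} :=
  (@mpolyC n A \o (u \o @mpolyC n k)).

(** The polynomial f(a + t b) with generic [a] and [b]: the a_i are the
    variables over [A], and the b_i are in [A]. *)
Definition generic_line (f : {mpoly k[n]}) : P :=
  line generic_iota (fun i => 'X_i) (fun i => (u 'X_i)%:MP) f.
HB.instance Definition _ := GRing.RMorphism.copy generic_line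
  (line generic_iota (fun i => 'X_i) (fun i => (u 'X_i)%:MP)).

Lemma generic_lineC c : generic_line c%:MP = (u c%:MP)%:MP%:P.
Proof. exact: lineC. Qed.

Lemma generic_lineXU i : generic_line 'X_i = ('X_i)%:P + (u 'X_i)%:MP%:P * 'X.
Proof. by rewrite /generic_line lineXU mul_polyC. Qed.

Lemma coef_generic_line d f : f \is d.-homog -> (generic_line f)`_d = (u f)%:MP.
Proof.
move=> hf; rewrite (coef_line_homog _ _ _ hf).
apply: (mpoly_rmorph_eq (g := mmap generic_iota _) (h := @mpolyC n A \o u)) => [c|i] /=.
  by rewrite mmapC.
by rewrite mmapX mmap1U.
Qed.

Let inner : {rmorphism {mpoly k[n]} -> C} :=
  mmap (polyC \o (@mpolyC n {mpoly k[n]} \o @mpolyC n k)) (fun i => ('X_i)%:P).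

Let innerC c : inner c%:MP = c%:MP%:MP%:P.
Proof. exact: mmapC. Qed.

Let innerXU i : inner 'X_i = ('X_i)%:P.
Proof. by rewrite /inner /= mmapX mmap1U. Qed.

(* G and its inverse G' are the change of variables a = x - t b, which turns
   f(a + t b) into f(x) and its t-derivative into the generic derivative. *)
Let G : {rmorphism P -> C} :=
  assign (inner \o u') (fun i => ('X_i)%:MP%:P - ('X_i)%:P * 'X) 'X.

Let G' : {rmorphism C -> P} :=
  assign generic_line (fun i => (u 'X_i)%:MP%:P) 'X.

Let GX : G 'X = 'X. Proof. exact: assignX. Qed.
Let GXU i : G ('X_i)%:P = ('X_i)%:MP%:P - ('X_i)%:P * 'X. Proof. exact: assignXU. Qed.
Let GC a : G (u a)%:MP%:P = inner a.
Proof. by rewrite -[in RHS](uK a); exact: assignC. Qed.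
Let G'X : G' 'X = 'X. Proof. exact: assignX. Qed.
Let G'XU i : G' ('X_i)%:P = (u 'X_i)%:MP%:P. Proof. exact: assignXU. Qed.
Let G'C a : G' a%:MP%:P = generic_line a. Proof. exact: assignC. Qed.

Let G'inner p : G' (inner p) = (u p)%:MP%:P.
Proof.
apply: (mpoly_rmorph_eq (g := G' \o inner) (h := polyC \o (@mpolyC n A \o u))) => [c|i].
  exact: etrans (congr1 G' (innerC c)) (etrans (G'C _) (generic_lineC c)).
exact: etrans (congr1 G' (innerXU i)) (G'XU i).
Qed.

Let GK : cancel G G'.
Proof.
apply: (assign_ext (g := G' \o G) (h := idfun)) => [a|i|].
- rewrite -[a]u'K; exact: etrans (congr1 G' (GC _)) (G'inner _).
- apply: etrans (congr1 G' (GXU i)) _; apply: etrans (rmorphB G' _ _) _.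
  have E : G' (('X_i)%:P * 'X) = (u 'X_i)%:MP%:P * 'X.
    exact: etrans (rmorphM G' _ _) (congr2 *%R (G'XU i) G'X).
  by rewrite E G'C generic_lineXU addrK.
- exact: etrans (congr1 G' GX) G'X.
Qed.

Let Gline p : G (generic_line p) = p%:MP%:P.
Proof.
apply: (mpoly_rmorph_eq (g := G \o generic_line)
  (h := polyC \o @mpolyC n {mpoly k[n]})) => [c|i].
  exact: etrans (congr1 G (generic_lineC c)) (etrans (GC _) (innerC c)).
apply: etrans (congr1 G (generic_lineXU i)) _; apply: etrans (rmorphD G _ _) _.
have E : G ((u 'X_i)%:MP%:P * 'X) = ('X_i)%:P * 'X.
  apply: etrans (rmorphM G _ _) (congr2 *%R _ GX); exact: etrans (GC _) (innerXU i).
by rewrite E GXU subrK.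
Qed.

Let Gderiv f : G (generic_line f)^`() = (\sum_i 'X_i * (f^`M(i))%:MP)%:P.
Proof.
rewrite deriv_line; apply: etrans (rmorph_sum G _ _ _) _.
rewrite [RHS]rmorph_sum; apply: eq_bigr => i _.
rewrite -mul_polyC; apply: etrans (rmorphM G _ _) _.
apply: etrans (congr2 *%R (etrans (GC _) (innerXU i)) (Gline _)) _.
exact: esym (polyCM _ _).
Qed.

Lemma rdvd_generic_line (f : {mpoly k[n]}) (W : P) : f != 0 ->
    reduced_quotient (rdvd f) ->
  rdvd (generic_line f) (W * (generic_line f)^`()) -> rdvd (generic_line f) W.
Proof.
move=> f0 redf [v Ev].
have [z Ez] : rdvd f%:MP%:P (G W).
  apply: (rdvd_of_rdvd_generic_deriv f0 redf).
  exists (G v); rewrite -Gderiv; apply: etrans (esym (rmorphM G _ _)) _.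
  apply: etrans (congr1 G Ev) _; apply: etrans (rmorphM G _ _) _.
  by congr (_ * _); exact: Gline.
exists (G' z); rewrite -[LHS]GK; apply: etrans (congr1 G' Ez) _.
by apply: etrans (rmorphM G' _ _) _; congr (_ * _); exact: G'C.
Qed.

Lemma separable_generic_line d (f : {mpoly k[n]}) : f != 0 -> f \is d.-homog ->
  reduced_quotient (rdvd f) -> separable_poly (generic_line f).
Proof.
move=> f0 hf redf; apply: separable_of_rdvd => [|W]; last exact: rdvd_generic_line.
apply: contraNneq f0 => /(congr1 (fun p : P => p`_d)).
rewrite (coef_generic_line hf) coef0 => /eqP.
by rewrite mpolyC_eq0 -(inj_eq (can_inj uK)) rmorph0.
Qed.

End GenericLine.

(** * Existence of a transverse line *)

Section TransverseLine.
Local Open Scope ring_scope.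
Variables (k : finFieldType) (n : nat).

(** The resultant of f(a + t b) and its t-derivative has degree at most d (d - 1)
    in a. This degree being less than q, there is a rational point a such that
    f(a + t b) is separable for generic b, and so is f(b + t a). *)
Lemma exists_separable_direction (A : idomainType)
    (u : {rmorphism {mpoly k[n]} -> A}) (u' : {rmorphism A -> {mpoly k[n]}}) d f :
    cancel u u' -> cancel u' u ->
    (0 < d)%N -> f != 0 -> f \is d.-homog -> reduced_quotient (rdvd f) ->
    (d * (d - 1) < #|k|)%N ->
  exists a : 'I_n -> k,
    let q := line (u \o @mpolyC n k) (fun i => u 'X_i) (fun i => u (a i)%:MP) f in
    separable_poly q /\ (d <= size q <= d.+1)%N.
Proof.
move=> uK u'K d0 f0 hf redf ltq.
set P := generic_line u f.
have sepP : separable_poly P := separable_generic_line uK u'K f0 hf redf.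
have uf0 : u f != 0 by rewrite -(rmorph0 u) (inj_eq (can_inj uK)).
have Pd : P`_d != 0 by rewrite (coef_generic_line u hf) mpolyC_eq0.
have sizeP : size P = d.+1.
  apply/eqP; rewrite eqn_leq size_line //=; apply: contraNT Pd.
  by rewrite -leqNgt => leP; rewrite nth_default.
have wtP : wt_le d P.
  by apply: wt_le_line => // c; rewrite msizeC; case: (_ != 0).
have Res0 : resultant P P^`() != 0.
  by rewrite -separable_resultant // separable_poly_neq0.
pose E := [seq u c%:MP | c <- enum k].
have uniqE : uniq E.
  rewrite map_inj_uniq ?enum_uniq // => x y /(can_inj uK)/eqP.
  by rewrite mpolyC_eq => /eqP.
have [|v vE Dv] := meval_neq0 uniqE Res0.
  rewrite size_map -cardE; apply: leq_trans ltq.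
  apply: leq_trans (msize_resultant_leq (v := d) (w := d - 1) wtP _) _.
    by apply: wt_le_deriv; rewrite subn1 prednK.
  by rewrite sizeP ltnS /= -addnBAC ?leqnn // [(_ * d)%N]mulnC subnn.
have /fin_all_exists[a va] i : exists c, v i = u c%:MP.
  by have /mapP[c _ ->] := vE i; exists c.
exists a => q; have := separable_of_resultant (phi := meval v) (p := P).
rewrite sizeP ltnS d0 => /(_ isT Dv).
rewrite (map_line (iota' := u \o @mpolyC n k) (a' := fun i => u (a i)%:MP) (b' := fun i => u 'X_i)).
- set p := line _ _ _ f => sep_p.
  have -> : q = rev_poly d p by rewrite (rev_line _ _ _ hf).
  split; last exact: size_rev_separable.
  apply: separable_rev => //; rewrite size_line // andbT ltnW // ltnNge.
  apply: contra uf0 => lep; have := coef_line_homog (u \o @mpolyC n k)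
    (fun i => u (a i)%:MP) (fun i => u 'X_i) hf.
  rewrite nth_default // => ->; apply/eqP/esym.
  apply: (mpoly_rmorph_eq (g := mmap (u \o @mpolyC n k) _) (h := u)) => [c|i] /=.
    by rewrite mmapC.
  by rewrite mmapX mmap1U.
- by move=> c /=; rewrite mevalC.
- by move=> i /=; rewrite mevalXU.
- by move=> i /=; rewrite mevalC.
Qed.

End TransverseLine.

Section SpecialLine.
Local Open Scope ring_scope.
Variables (k : idomainType) (n : nat).

(** For a point [a] such that f(b + t a) is separable for generic b, the
    product of the resultant with the leading coefficient has degree at most
    d (d - 1) in b, which provides a rational b. The leading coefficient
    controls the intersection multiplicity at [a]. *)
Lemma exists_transverse_line_through (E : seq k) d (f : {mpoly k[n]}) a :
    let q := line (@mpolyC n k) (fun i => 'X_i) (fun i => (a i)%:MP) f in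
    separable_poly q -> (d <= size q <= d.+1)%N ->
    (1 < d)%N -> f \is d.-homog -> uniq E -> (d * (d - 1) < size E)%N ->
  exists b : 'I_n -> k, f.@[b] != 0 /\ separable_poly (line idfun a b f).
Proof.
move=> q sep_q /andP[geq leq] d1 hf uniqE ltE.
have q0 : q != 0 by exact: separable_poly_neq0.
have wtq : wt_le d q.
  by apply: wt_le_line => // c; rewrite msizeC; case: (_ != 0).
have D0 : resultant q q^`() * lead_coef q != 0.
  by rewrite mulf_neq0 ?lead_coef_eq0 // -separable_resultant.
have [|b bE] := meval_neq0 uniqE D0.
  apply: leq_trans ltE.
  have lc_le : (msize (lead_coef q) <= (d - (size q).-1).+1)%N.
    by apply: leq_trans (wtq _) _; move: (size q).-1 => s; lia.
  have wtq' : wt_le (d - 1) q^`() by apply: wt_le_deriv; rewrite subn1 prednK // ltnW.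
  apply: leq_trans (msize_mul_leq (msize_resultant_leq wtq wtq') lc_le) _.
  rewrite ltnS; have : (size q^`() <= (size q).-1)%N by exact: size_poly.
  move: (size q^`()) (size q) geq leq d1 => e s; nia.
rewrite mevalM mulf_eq0 negb_or => /andP[Db lb].
pose p := line idfun b a f.
have Ep : map_poly (meval b) q = p.
  apply: map_line => [c|i|i] /=; by rewrite ?mevalC ?mevalXU.
have size_p : size p = size q by rewrite -Ep size_map_poly_id0.
have sep_p : separable_poly p.
  rewrite -Ep; apply: separable_of_resultant => //.
  by apply: leq_trans geq.
(* Moving b along the line makes f nonzero at b. *)
have [c cE pc] : exists2 c, c \in E & p.[c] != 0.
  apply/hasP; apply: contraT => /hasPn allE.
  have /(max_poly_roots (separable_poly_neq0 sep_p))/(_ uniqE) : all (root p) E.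
    by apply/allP => c /allE/negbNE; rewrite rootE.
  rewrite size_p; move: (size q) (size E) leq ltE d1 => s l; nia.
pose bc i := b i + a i * c.
exists bc; have Eline : p \Po (c%:P + 1 *: 'X) = line idfun bc a f.
  by rewrite line_comp; apply: line_eq => i //; rewrite mulr1.
split.
  by move: pc; rewrite horner_line.
have -> : line idfun a bc f = rev_poly d (p \Po (c%:P + 1 *: 'X)).
  by rewrite Eline (rev_line _ _ _ hf).
apply: separable_rev; last 1 first.
- rewrite separableE deriv_comp derivD derivC add0r scale1r derivX mulr1.
  by rewrite coprimep_comp_poly // -separableE.
- rewrite scale1r size_comp_poly2 ?size_p ?geq // addrC; exact: size_XaddC.
exact: ltnW.
Qed.

End SpecialLine.

Section TransverseLineFinite.
Local Open Scope ring_scope.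

Lemma exists_transverse_line (k : finFieldType) n d (f : {mpoly k[n]}) :
    (1 < d)%N -> f != 0 -> f \is d.-homog -> reduced_quotient (rdvd f) ->
    (d * (d - 1) < #|k|)%N ->
  exists a b : 'I_n -> k, f.@[b] != 0 /\ separable_poly (line idfun a b f).
Proof.
move=> d1 f0 hf redf ltq.
have [a [sep_q size_q]] := @exists_separable_direction k n {mpoly k[n]} idfun idfun d f
  (fun=> erefl) (fun=> erefl) (ltnW d1) f0 hf redf ltq.
exists a.
apply: (@exists_transverse_line_through k n (enum k) d f a sep_q size_q d1 hf).
  exact: enum_uniq.
by rewrite -cardE.
Qed.
End TransverseLineFinite.

(** * Reducedness from a transverse line *)

Section ReducedFromLine.
Local Open Scope ring_scope.

Lemma rmorph_resultant (R S : nzRingType) (phi : {rmorphism R -> S}) (p q : {poly R}) :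
    phi (lead_coef p) != 0 -> phi (lead_coef q) != 0 ->
  phi (resultant p q) = resultant (map_poly phi p) (map_poly phi q).
Proof.
move=> nz_p nz_q; rewrite /resultant /Sylvester_mx !size_map_poly_id0 //.
rewrite -det_map_mx /= map_col_mx; congr (\det (col_mx _ _));
  by apply: map_lin1_mx => v; rewrite map_poly_rV rmorphM /= map_rVpoly.
Qed.

(** The resultant of p and p + p' is used, since both have the leading
    coefficient of p, so that it commutes with the morphism. *)
Lemma separable_of_map (R S : idomainType) (phi : {rmorphism R -> S}) (p : {poly R}) :
    phi (lead_coef p) != 0 -> separable_poly (map_poly phi p) -> separable_poly p.
Proof.
move=> lp sep_p; set q := p + p^`().
have p0 : p != 0 by apply: contraNneq lp => ->; rewrite lead_coef0 rmorph0.
have lq : lead_coef q = lead_coef p by rewrite lead_coefDl // lt_size_deriv.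
have : resultant p q != 0.
  have: phi (resultant p q) != 0.
    rewrite rmorph_resultant ?lq // resultant_eq0 rmorphD /= -deriv_map.
    rewrite (eqp_size (gcdp_addl _ _)) -leqNgt.
    by move: sep_p; rewrite separableE /coprimep => /eqP->.
  by apply: contraNneq => ->; rewrite rmorph0.
rewrite resultant_eq0 (eqp_size (gcdp_addl _ _)) -leqNgt => le1.
rewrite separableE /coprimep eqn_leq le1 size_poly_gt0 gcdp_eq0 negb_and.
by rewrite p0.
Qed.

Lemma separable_dvdp_exp (R : idomainType) (p q : {poly R}) m :
  separable_poly p -> p %| q ^+ m -> p %| q.
Proof.
move=> sep_p dvd; have p0 := separable_poly_neq0 sep_p.
set g := gcdp p q; have := Pdiv.Idomain.divpKC (dvdp_gcdl p q); rewrite -/g.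
set h := p %/ g; set c := lead_coef g ^+ _ => Eh.
have g0 : g != 0 by rewrite gcdp_eq0 negb_and p0.
have c0 : c != 0 by rewrite expf_neq0 // lead_coef_eq0.
have ghp : g * h %| p by rewrite Eh dvdpZl.
have [/(_ g h ghp) cop_gh _] := separable_polyP sep_p.
have hp : h %| p by apply: dvdp_trans ghp; apply: dvdp_mulIr.
have cop_hq : coprimep h q.
  apply: contraT => ncop; have : coprimep (gcdp h q) (gcdp h q).
    apply: (coprimep_dvdl (dvdp_gcdl h q)); apply: coprimep_dvdr cop_gh.
    by rewrite dvdp_gcd (dvdp_trans (dvdp_gcdl _ _) hp) dvdp_gcdr.
  by rewrite coprimepp => /eqP E; rewrite /coprimep E in ncop.
have : coprimep h h.
  exact: coprimep_dvdl (dvdp_trans hp dvd) (coprimep_expr m cop_hq).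
rewrite coprimepp => /size_poly1P[a a0 Ea].
have : p %| g by rewrite -(dvdpZr _ _ a0) -mul_polyC -Ea mulrC Eh dvdpZr.
by move/dvdp_trans; apply; apply: dvdp_gcdr.
Qed.

(** If g is not zero at b and is separable on the line through a and b, the
    cone g = 0 is reduced: translating by t b turns g into a polynomial in t
    with invertible leading coefficient, separable since it is at the point a,
    and a power divisible by a separable polynomial has a divisible base. *)
Lemma reduced_of_separable_line (K : fieldType) n d (g : {mpoly K[n]}) (a b : 'I_n -> K) :
    g \is d.-homog -> g.@[b] != 0 -> separable_poly (line idfun a b g) ->
  reduced_quotient (rdvd g).
Proof.
move=> hg gb sep p m [c Ec].
pose L := line (@mpolyC n K) (fun i => 'X_i) (fun i => (b i)%:MP).
have Lg_d : (L g)`_d = (g.@[b])%:MP.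
  rewrite (coef_line_homog _ _ _ hg).
  apply: (mpoly_rmorph_eq (g := mmap _ _) (h := @mpolyC n K \o meval b)) => [e|i] /=.
    by rewrite mmapC mevalC.
  by rewrite mmapX mmap1U mevalXU.
have size_L : size (L g) = d.+1.
  apply/eqP; rewrite eqn_leq size_line //= ltnNge; apply: contra gb => leL.
  by rewrite -(mpolyC_eq0 n) -Lg_d nth_default.
have lcL : lead_coef (L g) = (g.@[b])%:MP by rewrite lead_coefE size_L Lg_d.
have sepL : separable_poly (L g).
  apply: (separable_of_map (phi := meval a)); first by rewrite lcL /= mevalC.
  rewrite (map_line (iota' := idfun) (a' := a) (b' := b)) // => [e|i|i] /=.
  - exact: mevalC.
  - exact: mevalXU.
  - exact: mevalC.
have : L g %| L p.
  apply: (separable_dvdp_exp (m := m) sepL).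
  by rewrite -rmorphXn Ec rmorphM dvdp_mulIr.
have ulc : lead_coef (L g) \is a GRing.unit.
  by rewrite lcL rmorph_unit // unitfE.
case/(Pdiv.IdomainUnit.dvdpP ulc) => q /(congr1 (horner^~ 0)).
have L0 r : (L r).[0] = r.
  rewrite horner_line; apply: (mpoly_rmorph_eq (g := mmap _ _) (h := idfun)) => [e|i] /=.
    by rewrite mmapC.
  by rewrite mmapX mmap1U mulr0 addr0.
move=> E; exists q.[0]; apply: etrans (esym (L0 p)) _; apply: etrans E _.
by apply: etrans (hornerM _ _ _) _; congr (_ * _); apply: L0.
Qed.
End ReducedFromLine.

(** * Linear sections *)

Section LinearSubstitution.
Local Open Scope ring_scope.
Variable K : fieldType.

(** Restriction to a linear subspace: [lsubst M p] is p(y M), where y is the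
    row vector of the new variables. *)
Definition lsubst m n (M : 'M[K]_(m, n)) (p : {mpoly K[n]}) : {mpoly K[m]} :=
  mmap (@mpolyC m K) (fun j => \sum_l M l j *: 'X_l) p.
HB.instance Definition _ m n (M : 'M[K]_(m, n)) := GRing.RMorphism.copy (lsubst M)
  (mmap (@mpolyC m K) (fun j => \sum_l M l j *: 'X_l)).

Lemma lsubstC m n (M : 'M[K]_(m, n)) c : lsubst M c%:MP = c%:MP.
Proof. exact: mmapC. Qed.

Lemma lsubstXU m n (M : 'M[K]_(m, n)) j : lsubst M 'X_j = \sum_l M l j *: 'X_l.
Proof. by rewrite /lsubst mmapX mmap1U. Qed.

Lemma lsubstZ m n (M : 'M[K]_(m, n)) c p : lsubst M (c *: p) = c *: lsubst M p.
Proof. by rewrite -!mul_mpolyC rmorphM /= lsubstC. Qed.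

Lemma lsubst_linform m n (M : 'M[K]_(m, n)) (c : 'I_n -> K) :
  lsubst M (\sum_j c j *: 'X_j) = \sum_l (\sum_j c j * M l j) *: 'X_l.
Proof.
rewrite rmorph_sum.
under eq_bigr => j _ do rewrite /= lsubstZ lsubstXU scaler_sumr.
rewrite exchange_big; apply: eq_bigr => l _.
by rewrite scaler_suml; apply: eq_bigr => j _; rewrite scalerA.
Qed.

Lemma lsubst_lsubst m n p (M : 'M[K]_(m, n)) (M' : 'M[K]_(p, m)) q :
  lsubst M' (lsubst M q) = lsubst (M' *m M) q.
Proof.
apply: (mpoly_rmorph_eq (g := lsubst M' \o lsubst M)) => [c|j] /=.
  by rewrite !lsubstC.
rewrite !lsubstXU lsubst_linform; apply: eq_bigr => l _; congr (_ *: _).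
by rewrite mxE; apply: eq_bigr => i _; rewrite mulrC.
Qed.

Lemma lsubst1 n q : lsubst (1%:M : 'M[K]_n) q = q.
Proof.
apply: (mpoly_rmorph_eq (g := lsubst 1%:M) (h := idfun)) => [c|j] /=; first exact: lsubstC.
rewrite lsubstXU (bigD1 j) //= mxE eqxx scale1r big1 ?addr0 // => l nlj.
by rewrite mxE (negbTE nlj) scale0r.
Qed.

Lemma lsubst_homog m n (M : 'M[K]_(m, n)) d q : q \is d.-homog -> lsubst M q \is d.-homog.
Proof.
move=> /dhomogP hq; rewrite /lsubst /mmap big_seq rpred_sum // => u /hq Eu.
rewrite mul_mpolyC rpredZ // -(Eu : mdeg u = d) mdegE /mmap1.
apply: (big_ind2 (fun (r : {mpoly K[m]}) e => r \is e.-homog)) => [||j _].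
- exact: dhomog1.
- by move=> r e r' e' hr hr'; apply: dhomogM.
rewrite -[X in X.-homog]mul1n; apply: dhomogMn; rewrite rpred_sum // => l _.
by rewrite rpredZ // dhomogX; apply/eqP; apply: mdeg1.
Qed.

Lemma meval_lsubst m n (M : 'M[K]_(m, n)) (y : 'I_m -> K) q :
  (lsubst M q).@[y] = q.@[fun j => \sum_l y l * M l j].
Proof.
apply: (mpoly_rmorph_eq (g := meval y \o lsubst M) (h := meval _)) => [c|j] /=.
  by rewrite lsubstC !mevalC.
rewrite lsubstXU mevalXU raddf_sum; apply: eq_bigr => l _.
by rewrite /= mevalZ mevalXU mulrC.
Qed.

Lemma line_lsubst m n (M : 'M[K]_(m, n)) (y z : 'I_m -> K) q :
  line idfun y z (lsubst M q) =
    line idfun (fun j => \sum_l y l * M l j) (fun j => \sum_l z l * M l j) q.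
Proof.
apply: (mpoly_rmorph_eq (g := line idfun y z \o lsubst M) (h := line idfun _ _)) => [c|j] /=.
  by rewrite lsubstC !lineC.
rewrite lsubstXU lineXU rmorph_sum raddf_sum scaler_suml -big_split.
apply: eq_bigr => l _; rewrite /= -mul_mpolyC rmorphM /= lineC lineXU mulrDr.
by rewrite -polyCM mul_polyC scalerA mulrC [M l j * _]mulrC.
Qed.

End LinearSubstitution.

Section LinearSections.
Local Open Scope ring_scope.
Variables (K : fieldType) (m n : nat) (T : {vspace 'rV[K]_n.+1}).
Variables (W : 'M[K]_(m, n.+1)) (B : 'M[K]_(n.+1, m)).
Hypothesis WB : W *m B = 1%:M.
Hypothesis TW : forall v, v \in T <-> exists u, v = u *m W.

(** The chart x_i = 1 of the section by T, parametrized by the rows of W, is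
    the chart of the restricted equation where the restriction of x_i is 1. The
    right inverse B of W gives a section of the restriction morphism. *)
Lemma chart_ideal_section (f p : {mpoly K[n.+1]}) i :
  chart_ideal (scheme_inter (hypersurface f) (linear_subscheme T)) i p <->
  dehomog_ideal (lsubst W f) (lsubst W 'X_i) (lsubst W p).
Proof.
set J := chart_ideal _ i.
have idJ : is_ideal J by exact: ideal_ideal_gen.
have Jf : J f by apply: ideal_gen_mem; do 2!left.
have Ji : J ('X_i - 1) by apply: ideal_gen_mem; right.
have Jlin (c : 'rV[K]_n.+1) : (forall w, w \in T -> \sum_j c 0 j * w 0 j = 0) -> J (\sum_j c 0 j *: 'X_j).
  by move=> Tc; apply: ideal_gen_mem; left; right; exists c.
split=> [|[a [b Eab]]].
  set I := fun q => dehomog_ideal (lsubst W f) (lsubst W 'X_i) (lsubst W q).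
  apply: (@ideal_gen_min _ _ I) => [|q]; have idI := ideal_dehomog_ideal (lsubst W f) (lsubst W 'X_i).
    split; first by rewrite /I rmorph0; case: idI.
      by move=> u v Iu Iv; rewrite /I rmorphD; apply: idealD.
    by move=> u v Iv; rewrite /I rmorphM; apply: idealM.
  rewrite /I; case=> [[->|[c -> Tc]]|->].
  - by exists 1, 0; rewrite mul1r mul0r addr0.
  - rewrite lsubst_linform big1; first by case: idI.
    move=> l _; rewrite (_ : \sum_j _ = 0) ?scale0r //.
    transitivity (\sum_j c 0 j * (row l W) 0 j); first by apply: eq_bigr => j _; rewrite mxE.
    by apply: Tc; apply/TW; exists (delta_mx 0 l); rewrite -rowE.
  - by exists 0, 1; rewrite mul0r add0r mul1r rmorphB rmorph1.
have retr q : J (q - lsubst B (lsubst W q)).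
  rewrite lsubst_lsubst; apply: (mpoly_rmorph_congr idJ (g := idfun) (h := lsubst (B *m W))) => [c|j] /=.
    by rewrite lsubstC subrr; case: idJ.
  rewrite lsubstXU; pose c : 'rV[K]_n.+1 := \row_l ((l == j)%:R - (B *m W) l j).
  have -> : 'X_j - \sum_l (B *m W) l j *: 'X_l = \sum_l c 0 l *: 'X_l.
    under [RHS]eq_bigr => l _ do rewrite mxE scalerBl.
    rewrite sumrB; congr (_ - _); rewrite (bigD1 j) //= eqxx scale1r big1 ?addr0 //.
    by move=> l /negbTE->; rewrite scale0r.
  apply: Jlin => w /TW[u ->].
  under eq_bigr => l _ do rewrite mxE mulrBl.
  rewrite sumrB (bigD1 j) //= eqxx mul1r big1 ?addr0; last first.
    by move=> l /negbTE->; rewrite mul0r.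
  apply/eqP; rewrite subr_eq0; apply/eqP.
  transitivity ((u *m W *m (B *m W)) 0 j).
    by rewrite mulmxA -(mulmxA u) WB mulmx1.
  by rewrite mxE; apply: eq_bigr => l _; rewrite mulrC.
apply: (ideal_congr idJ (retr p)); rewrite Eab rmorphD !rmorphM rmorphB rmorph1 /=.
apply: (idealD idJ); apply: (idealM idJ).
  exact: (ideal_congr idJ (ideal_subC idJ (retr f)) Jf).
rewrite (_ : _ - 1 = 'X_i - 1 - ('X_i - lsubst B (lsubst W 'X_i))); last by ring.
by apply: (idealB idJ) => //; apply: retr.
Qed.

Lemma reduced_section d (f : {mpoly K[n.+1]}) : f \is d.-homog ->
    reduced_quotient (rdvd (lsubst W f)) ->
  reduced_scheme (scheme_inter (hypersurface f) (linear_subscheme T)).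
Proof.
move=> hf redf i p e /chart_ideal_section H; apply/chart_ideal_section.
have hX : ('X_i : {mpoly K[n.+1]}) \is 1.-homog.
  by rewrite dhomogX; apply/eqP; apply: mdeg1.
apply: (reduced_dehomog_ideal (lsubst_homog W hf) (lsubst_homog W hX) redf (m := e)).
by rewrite -rmorphXn.
Qed.

End LinearSections.

(** * Chains of primes and Krull boundaries *)

Section Boundaries.
Local Open Scope ring_scope.
Variable R : comNzRingType.
Implicit Types (J S : R -> Prop) (x v : R) (xs : seq R).

(** The iterated Krull boundary of the sequence [xs] with respect to [S]: the
    elements x_1^e_1 (... x_l^e_l (s + x_l w_l) ... + x_1 w_1), with s in [S].
    When [S] is the set of nonzero constants it contains the values at [xs] of
    all nonzero polynomials. *)
Fixpoint iterated_boundary S xs v : Prop :=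
  if xs is x :: xs' then
    exists e u w, iterated_boundary S xs' u /\ v = x ^+ e * (u + x * w)
  else S v.

Lemma iterated_boundary1 S xs : S 1 -> iterated_boundary S xs 1.
Proof.
move=> S1; elim: xs => //= x xs IHxs; exists 0, 1, 0; split=> //.
by rewrite expr0 mulr0 addr0 mulr1.
Qed.

Lemma iterated_boundaryM S xs u v : (forall a b, S a -> S b -> S (a * b)) ->
  iterated_boundary S xs u -> iterated_boundary S xs v -> iterated_boundary S xs (u * v).
Proof.
move=> SM; elim: xs u v => [|x xs IHxs] u v /=; first exact: SM.
move=> [e [a [w [Ua ->]]]] [e' [a' [w' [Ua' ->]]]].
exists (e + e')%N, (a * a'), (a * w' + w * a' + x * w * w'); split; first exact: IHxs.
by rewrite exprD; ring.
Qed.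

(** Factor out the first nonzero term of a polynomial in x. *)
Lemma iterated_boundary_sum S xs x M (h : nat -> R) :
    (exists2 e, (e < M)%N & h e != 0) ->
    (forall e, h e != 0 -> iterated_boundary S xs (h e)) ->
  iterated_boundary S (x :: xs) (\sum_(e < M) x ^+ e * h e).
Proof.
elim: M h => [|M IHM] h; first by case.
move=> [e lte he] Uh; rewrite big_ord_recl expr0 mul1r.
have shift : \sum_(i < M) x ^+ bump 0 i * h (bump 0 i) =
    x * \sum_(i < M) x ^+ i * h i.+1.
  by rewrite mulr_sumr; apply: eq_bigr => i _; rewrite mulrA -exprS.
rewrite [X in _ + X]shift; have [h0|h0] := eqVneq (h 0%N) 0; last first.
  exists 0%N, (h 0%N), (\sum_(i < M) x ^+ i * h i.+1).
  by rewrite expr0 mul1r; split; first exact: Uh.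
have [||e' [u [w [Uu ->]]]] := IHM (fun i => h i.+1).
- by case: e lte he => [|e] lte he; [rewrite h0 eqxx in he|exists e].
- by move=> i; apply: Uh.
by exists e'.+1, u, w; split=> //; rewrite h0 add0r exprS mulrA.
Qed.

(** An ideal maximal among those that contain J and avoid the multiplicative
    set S is prime. *)
Lemma exists_prime_ideal J S : is_ideal J -> S 1 ->
    (forall a b, S a -> S b -> S (a * b)) -> (forall v, S v -> ~ J v) ->
  exists P : {pred R}, [/\ idealr_closed P, prime_idealr_closed P,
    forall v, J v -> v \in P & forall v, S v -> v \notin P].
Proof.
move=> idJ S1 SM SJ.
pose good (I : R -> Prop) := [/\ is_ideal I, forall v, J v -> I v & forall v, S v -> ~ I v].
(* The empty set is added to accommodate the empty chain. *)
pose X (I : R -> Prop) := (forall v, ~ I v) \/ good I.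
have [F FX Ftot|I [XI Imax]] := @classical_sets.Zorn_bigcup R X.
  have [[I0 FI0 [a0 Ia0]]|noI] := boolp.pselect (exists2 I, F I & exists a, I a); last first.
    by left=> v [I FI Iv]; apply: noI; exists I => //; exists v.
  have goodF I a : F I -> I a -> good I by move=> FI Ia; case: (FX I FI) => // /(_ a).
  have [[I00 _ _] JI0 _] := goodF _ _ FI0 Ia0.
  right; split; last 1 first.
  - by move=> v Sv [I FI Iv]; have [_ _ /(_ v Sv)] := goodF _ _ FI Iv.
  - split; first by exists I0.
      move=> a b [I FI Ia] [I' FI' Ib]; case: (Ftot _ _ FI FI') => sub.
        exists I' => //; have [idI' _ _] := goodF _ _ FI' Ib.
        by apply: (idealD idI') => //; apply: sub.
      exists I => //; have [idI _ _] := goodF _ _ FI Ia.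
      by apply: (idealD idI) => //; apply: sub.
    move=> c a [I FI Ia]; exists I => //; have [idI _ _] := goodF _ _ FI Ia.
    exact: (idealM idI).
  - by move=> v /JI0 I0v; exists I0.
have goodJ : good J by split.
have {XI} [idI JI SI] : good I.
  case: XI => // I0; case: (Imax J); last by right.
  split; first by move=> a /I0.
  by move=> sub; apply: (I0 0); apply: sub; case: idJ.
pose P : {pred R} := fun v => boolp.asbool (I v).
have PP v : reflect (I v) (v \in P) by apply: boolp.asboolP.
have meetS u : ~ I u -> exists s c, S s /\ I (s - c * u).
  move=> nIu; apply: boolp.contrapT => noS.
  pose I' v := exists c, I (v - c * u).
  have subI : forall v, I v -> I' v by move=> v Iv; exists 0; rewrite mul0r subr0.
  apply: (Imax I').
    split; first exact: subI.
    by move=> sub; apply/nIu/sub; exists 1; rewrite mul1r subrr; case: idI.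
  right; split; first split.
  - by apply: subI; case: idI.
  - move=> a b [c Ha] [c' Hb]; exists (c + c').
    have -> : a + b - (c + c') * u = (a - c * u) + (b - c' * u) by ring.
    exact: idealD.
  - move=> e a [c Ha]; exists (e * c).
    have -> : e * a - e * c * u = e * (a - c * u) by ring.
    exact: idealM.
  - by move=> v /JI/subI.
  - by move=> v Sv [c Ic]; apply: noS; exists v, c.
exists P; split.
- split; first by apply/PP; case: idI.
    by apply/PP; apply: SI.
  by move=> a u v /PP Iu /PP Iv; apply/PP/(idealD idI) => //; apply: (idealM idI).
- move=> u v /PP Iuv; apply: contraT; rewrite negb_or => /andP[/PP nu /PP nv].
  have [s [c [Ss Is]]] := meetS u nu; have [t [e [St It]]] := meetS v nv.
  case: (SI (s * t)); first exact: SM.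
  have -> : s * t = t * (s - c * u) + c * u * (t - e * v) + c * e * (u * v) by ring.
  by apply: (idealD idI); [apply: (idealD idI)|]; apply: (idealM idI).
- by move=> v /JI/PP.
- by move=> v /SI; apply: contra_notN => /PP.
Qed.

(** If the boundary of x_1, ..., x_l avoids J, primes P_0 < ... < P_l above J
    are constructed such that x_i is in P_i but not in P_(i-1). *)
Lemma prime_chain_of_boundary J S xs : is_ideal J -> S 1 ->
    (forall a b, S a -> S b -> S (a * b)) ->
    (forall v, iterated_boundary S xs v -> ~ J v) ->
  exists P, prime_chain J (size xs) P.
Proof.
move=> idJ S1 SM; elim: xs J idJ => [|x xs IHxs] J idJ UJ.
  have [P [idP prP JP _]] := exists_prime_ideal idJ S1 SM UJ.
  by exists (fun _ => P); split.
have [P0 [idP0 prP0 JP0 UP0]] := exists_prime_ideal idJ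
  (@iterated_boundary1 S (x :: xs) S1) (fun a b => @iterated_boundaryM S (x :: xs) a b SM) UJ.
have [P00 _ P0D] := idP0.
pose J' v := exists w, v - x * w \in P0.
have idJ' : is_ideal J'.
  split; first by exists 0; rewrite mulr0 subr0.
    move=> a b [w Ha] [w' Hb]; exists (w + w').
    have -> : a + b - x * (w + w') = 1 * (a - x * w) + (b - x * w') by ring.
    exact: P0D.
  move=> c a [w Ha]; exists (c * w).
  have -> : c * a - x * (c * w) = c * (a - x * w) + 0 by ring.
  exact: P0D.
have [P [idP JP strP]] : exists P, prime_chain J' (size xs) P.
  apply: IHxs => // v Uv [w]; apply/negP/UP0; exists 0%N, v, (- w); split=> //.
  by rewrite expr0 mul1r mulrN.
exists (fun i => if i is i'.+1 then P i' else P0); split.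
- by case=> [|i] //= lei; apply: idP.
- by move=> p /JP0.
case=> [|i] /= lti; last exact: strP.
split.
  by move=> p P0p; apply: JP; exists 0; rewrite mulr0 subr0.
exists x; first by apply: JP; exists 1; rewrite mulr1 subrr.
apply: UP0; exists 1%N, 1, 0; split; first exact: iterated_boundary1.
by rewrite expr1 mulr0 addr0 mulr1.
Qed.

(** Conversely, elements chosen in the successive differences of a chain have a
    boundary that avoids the smallest prime. *)
Lemma boundary_of_prime_chain J S l P : prime_chain J l P ->
    (forall c, S c -> exists c', c' * c = 1) ->
  exists2 xs, size xs = l & forall v, iterated_boundary S xs v -> v \notin P 0%N.
Proof.
move=> + unitS; elim: l P J => [|l IHl] P J [idP JP strP].
  exists [::] => // v /unitS[c Ec]; have [[P0 P1 PD] _] := idP 0%N isT.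
  apply: contra P1 => Pv; rewrite -Ec -[c * v]addr0; exact: PD.
have [|xs size_xs Uxs] := IHl (fun i => P i.+1) (fun v => v \in P 1%N).
  by split=> // i lei; [apply: idP|apply: strP].
have [sub01 [x Px nPx]] := strP 0%N isT.
have [[P00 P01 P0D] prP0] := idP 0%N isT; have [[P10 P11 P1D] prP1] := idP 1%N isT.
exists (x :: xs) => [|v [e [u [w [Uu ->]]]]]; first by rewrite /= size_xs.
apply: contraT => /negbNE.
have nPxe : x ^+ e \notin P 0%N.
  elim: e => [|e IHe]; first by rewrite expr0.
  by rewrite exprS; apply/negP => /prP0/orP[]; apply/negP.
move=> /prP0; rewrite (negbTE nPxe) /= => /sub01 Puw.
case/negP: (Uxs u Uu); have -> : u = (- w) * x + (u + x * w) by ring.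
exact: P1D.
Qed.

End Boundaries.

(** * Algebraic dependence by counting *)

(** The nonzero constants, a multiplicative set of units over a field. *)
Definition nonzero_const (R : nzRingType) m (p : {mpoly R[m]}) : Prop :=
  exists2 c, (c != 0)%R & p = (c%:MP)%R.

Lemma nonzero_const_unit (K : fieldType) m (p : {mpoly K[m]}) :
  nonzero_const p -> exists q, (q * p = 1)%R.
Proof.
by case=> c c0 ->; exists (c^-1)%:MP%R; rewrite -mpolyCM mulVf // mpolyC1.
Qed.

Section Counting.
Local Open Scope ring_scope.
Variables (k : finFieldType) (m : nat).
Local Notation D := {mpoly k[m]}.

Lemma size_bounded_mpolys (s : seq D) B : uniq s ->
    (forall p, p \in s -> msize p <= B)%N ->
  (size s <= #|k| ^ (B ^ m))%N.
Proof.
move=> uniq_s le_s.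
pose F (p : D) : {ffun {ffun 'I_m -> 'I_B} -> k} :=
  [ffun e : {ffun 'I_m -> 'I_B} => p@_[multinom nat_of_ord (e i) | i < m]].
have injF : {in s &, injective F}.
  move=> p q ps qs /ffunP Epq; apply/mpolyP => u.
  have [le|lt] := leqP B (mdeg u).
    by rewrite !memN_msupp_eq0 // msize_mdeg_ge // (leq_trans (le_s _ _) le).
  have ltu i : (u i < B)%N.
    by apply: leq_ltn_trans lt; rewrite mdegE (bigD1 i) //= leq_addr.
  have := Epq [ffun i => Ordinal (ltu i)]; rewrite !ffunE.
  have -> : [multinom nat_of_ord ([ffun i => Ordinal (ltu i)] i) | i < m] = u.
    by apply/mnmP => i; rewrite mnmE ffunE.
  by [].
have : uniq [seq F p | p <- s] by rewrite map_inj_in_uniq.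
move=> /card_uniqP; rewrite size_map => <-.
by apply: leq_trans (max_card _) _; rewrite !card_ffun !card_ord.
Qed.

(** The values at [xs] of the polynomials of degree less than M in each
    variable are pairwise distinct if 0 is not in the boundary. *)
Lemma many_boundary_values (xs : seq D) E M : 
    (forall x, x \in xs -> msize x <= E.+1)%N ->
    ~ iterated_boundary (@nonzero_const k m) xs 0 ->
  exists s : seq D, [/\ uniq s, size s = (#|k| ^ (M ^ size xs))%N,
    forall p q, p \in s -> q \in s -> p != q -> iterated_boundary (@nonzero_const k m) xs (p - q)
    & forall p, p \in s -> (msize p <= (E * (M * size xs)).+1)%N].
Proof.
elim: xs => [|x xs IHxs] lex nU0.
  exists [seq c%:MP | c <- enum k]; split.
  - rewrite map_inj_uniq ?enum_uniq // => a b /eqP.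
    by rewrite mpolyC_eq => /eqP.
  - by rewrite size_map -cardE expn0 expn1.
  - move=> _ _ /mapP[a _ ->] /mapP[b _ ->]; rewrite mpolyC_eq -subr_eq0 => ab.
    by exists (a - b); rewrite // mpolyCB.
  - by move=> _ /mapP[a _ ->]; rewrite msizeC muln0; case: (_ != 0).
have [||s [uniq_s size_s Us les]] := IHxs.
- by move=> y ys; apply: lex; rewrite inE ys orbT.
- move=> U0; apply: nU0; exists 0%N, 0, 0; split=> //.
  by rewrite mulr0 addr0 mulr0.
pose h (g : {ffun 'I_M -> 'I_(size s)}) e : D := if insub e is Some i then s`_(g i) else 0.
pose F g : D := \sum_(e < M) x ^+ e * h g e.
have hE g (i : 'I_M) : h g i = s`_(g i) by rewrite /h valK.
have UF g g' : g != g' -> iterated_boundary (@nonzero_const k m) (x :: xs) (F g - F g').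
  move=> neg; have -> : F g - F g' = \sum_(e < M) x ^+ e * (h g e - h g' e).
    by rewrite -sumrB; apply: eq_bigr => e _; rewrite mulrBr.
  apply: (@iterated_boundary_sum _ (@nonzero_const k m) xs x M (fun e => h g e - h g' e)).
    have [i gi] : exists i, g i != g' i.
      by apply/existsP; apply: contraNT neg => /existsPn eqg; apply/eqP/ffunP => i; apply/eqP/negbNE.
    by exists (i : nat); rewrite ?ltn_ord // !hE subr_eq0 nth_uniq ?ltn_ord.
  move=> e; rewrite /h; case: insubP => [i _ _|_]; last by rewrite subrr eqxx.
  by rewrite subr_eq0 => /Us; apply; rewrite mem_nth.
exists [seq F g | g <- enum {ffun 'I_M -> 'I_(size s)}]; split.
- rewrite map_inj_uniq ?enum_uniq // => g g' Eg; apply/eqP; apply: contraT => neg.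
  by case: nU0; rewrite -(subrr (F g')) -{1}Eg; apply: UF.
- by rewrite size_map -cardE card_ffun !card_ord size_s /= -expnM -expnSr.
- move=> _ _ /mapP[g _ ->] /mapP[g' _ ->] neF; apply: UF.
  by apply: contraNneq neF => ->.
move=> _ /mapP[g _ ->]; apply: msize_sum_leq => i _.
have := msize_mul_leq (msize_exp_leq i (lex x (mem_head _ _))) (les _ (mem_nth 0 (ltn_ord (g i)))).
rewrite hE => /leq_trans; apply; rewrite ltnS mulnS mulnDr leq_add2r leq_mul2l.
by rewrite ltnW ?orbT // ltn_ord.
Qed.

(** More than m polynomials in m variables are algebraically dependent, so that
    their boundary contains 0: otherwise there would be, for large M, too many
    polynomials of degree less than a multiple of M. *)
Lemma boundary_mpoly0 (xs : seq D) : (m < size xs)%N ->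
  iterated_boundary (@nonzero_const k m) xs 0.
Proof.
move=> lt_xs; apply: boolp.contrapT => nU0; set l := size xs in lt_xs.
pose E := (\max_(x <- xs) msize x)%N.
pose M := ((E * l).+1 ^ m).+1.
have lex x : x \in xs -> (msize x <= E.+1)%N.
  by move=> xxs; rewrite ltnW // ltnS /E; apply: leq_bigmax_seq.
have [s [uniq_s size_s _ les]] := many_boundary_values M lex nU0.
have := size_bounded_mpolys uniq_s les; rewrite size_s -/l.
rewrite leq_exp2l; last exact: finRing_gt1.
rewrite leqNgt => /negP[].
apply: (@leq_ltn_trans (((E * l).+1 * M) ^ m)).
  have [->|m0] := posnP m; first by rewrite !expn0.
  by rewrite leq_exp2r // mulSn -mulnA [(l * M)%N]mulnC -addn1 addnC leq_add2r.
apply: (@leq_trans (M ^ m.+1)); last by rewrite leq_exp2l // /M ltnS expn_gt0.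
by rewrite expnMn expnS ltn_pmul2r ?expn_gt0 // ltnSn.
Qed.
End Counting.

(** * Dimension of a linear section *)

Section BoundaryMorphisms.
Local Open Scope ring_scope.
Variables (R R' : comNzRingType) (phi : {rmorphism R -> R'}).
Variables (S : R -> Prop) (S' : R' -> Prop).

Lemma iterated_boundary_morph xs v : (forall c, S c -> S' (phi c)) ->
  iterated_boundary S xs v -> iterated_boundary S' (map phi xs) (phi v).
Proof.
move=> SS'; elim: xs v => [|x xs IHxs] v /=; first exact: SS'.
move=> [e [u [w [Uu ->]]]]; exists e, (phi u), (phi w); split; first exact: IHxs.
by rewrite rmorphM rmorphXn rmorphD rmorphM.
Qed.

Lemma iterated_boundary_lift xs v' : (forall w', exists w, phi w = w') ->
    (forall c', S' c' -> exists2 c, S c & phi c = c') ->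
  iterated_boundary S' (map phi xs) v' ->
  exists2 v, iterated_boundary S xs v & phi v = v'.
Proof.
move=> surj S'S; elim: xs v' => [|x xs IHxs] v' /=; first exact: S'S.
move=> [e [u' [w' [/IHxs[u Uu <-] ->]]]]; have [w <-] := surj w'.
exists (x ^+ e * (u + x * w)); first by exists e, u, w.
by rewrite rmorphM rmorphXn rmorphD rmorphM.
Qed.
End BoundaryMorphisms.

Section AffineHyperplane.
Local Open Scope ring_scope.
Variables (K : fieldType) (m : nat) (c : 'I_m -> K) (j : 'I_m).
Hypothesis cj : c j != 0.
Let l : {mpoly K[m]} := \sum_i c i *: 'X_i.
(** Elimination of the variable of index j by means of the equation l = 1. *)
Definition eliminate : {mpoly K[m]} -> {mpoly K[m]} :=
  msubst j ('X_j - (c j)^-1 *: (l - 1)).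
HB.instance Definition _ := GRing.RMorphism.copy eliminate
  (msubst j ('X_j - (c j)^-1 *: (l - 1))).

Lemma eliminateC a : eliminate a%:MP = a%:MP.
Proof. exact: msubstC. Qed.

Lemma eliminateXU i : i != j -> eliminate 'X_i = 'X_i.
Proof. by move=> nij; rewrite /eliminate msubstXU (negbTE nij). Qed.

Lemma eliminate_form : eliminate l = 1.
Proof.
rewrite rmorph_sum (bigD1 j) //=.
rewrite (eq_bigr (fun i => c i *: 'X_i)) => [|i nij]; last first.
  by rewrite -mul_mpolyC rmorphM /= eliminateC eliminateXU // mul_mpolyC.
rewrite -mul_mpolyC rmorphM /= eliminateC {1}/eliminate msubstXU eqxx mul_mpolyC.
rewrite scalerBr scalerA divff // scale1r.
have -> : l = c j *: 'X_j + \sum_(i < m | i != j) c i *: 'X_i by rewrite /l (bigD1 j).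
by ring.
Qed.

Lemma rdvd_eliminate p : rdvd (l - 1) p <-> eliminate p = 0.
Proof.
split=> [[a ->]|p0]; first by rewrite rmorphM rmorphB rmorph1 /= eliminate_form subrr mulr0.
have [a] := msubst_congr j ('X_j - (c j)^-1 *: (l - 1)) p.
rewrite -/(eliminate p) p0 subr0 opprB addrC subrK => ->.
by exists ((c j)^-1%:MP * a); rewrite -mul_mpolyC; ring.
Qed.

End AffineHyperplane.

Section DimensionUpper.
Local Open Scope ring_scope.
Variables (K : finFieldType) (m n : nat) (T : {vspace 'rV[K]_n.+1}).
Variables (W : 'M[K]_(m, n.+1)) (B : 'M[K]_(n.+1, m)).
Hypothesis WB : W *m B = 1%:M.
Hypothesis TW : forall v, v \in T <-> exists u, v = u *m W.

(** Let g and x be the restrictions of f and x_i. The chain is preceded by the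
    primes 0 < (x - 1), which x - 1 and g separate from their successors; the
    resulting l + 2 witnesses cannot be more than the m variables. *)
Lemma section_chain_leq d (f : {mpoly K[n.+1]}) i l P :
    f \is d.-homog -> lsubst W f != 0 ->
    prime_chain (chart_ideal (scheme_inter (hypersurface f) (linear_subscheme T)) i) l P ->
  (l.+2 <= m)%N.
Proof.
move=> hf g0 chP; rewrite leqNgt; apply/negP => lt_l.
have [idP JP _] := chP; have [[P0 P1 PD] prP] := idP 0%N isT.
have secE := chart_ideal_section WB TW f.
set g := lsubst W f in g0 secE; set x := lsubst W 'X_i.
have hx : x \is 1.-homog.
  by apply: lsubst_homog; rewrite dhomogX; apply/eqP; apply: mdeg1.
have hg : g \is d.-homog by exact: lsubst_homog.
have [xs size_xs Uxs] := boundary_of_prime_chain chP (@nonzero_const_unit K n.+1).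
have Pf : f \in P 0%N.
  by apply/JP/ideal_gen_mem; do 2!left.
have xE : x = \sum_l W l i *: 'X_l by rewrite /x lsubstXU.
have [j Wj|W0] := pickP (fun j => W j i != 0); last first.
  case/negP: P1; apply/JP/secE; exists 0, (- 1); rewrite rmorph1 -/x xE.
  by rewrite big1 => [|j _]; [ring|rewrite (eqP (negbFE (W0 j))) scale0r].
have x0 : x != 0.
  apply: contraTneq isT => E; have := congr1 (mcoeff U_(j)%MM) E.
  rewrite xE raddf_sum (bigD1 j) //= mcoeffZ mcoeffX eqxx mulr1 big1 ?addr0.
    by rewrite mcoeff0 => /eqP; rewrite (negbTE Wj).
  by move=> l' nl; rewrite mcoeffZ mcoeffX eq_mnm1 (negbTE nl) mulr0.
pose ys := ('X_i - 1) :: f :: xs.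
have : iterated_boundary (@nonzero_const K m) (map (lsubst W) ys) 0.
  by apply: boundary_mpoly0; rewrite size_map /= size_xs.
case/(iterated_boundary_lift (S := @nonzero_const K n.+1)) => [w|c'|v].
- by exists (lsubst B w); rewrite /= lsubst_lsubst WB lsubst1.
- by case=> e e0 ->; exists e%:MP; [exists e|rewrite /= lsubstC].
have elim p : rdvd (x - 1) p <-> eliminate (fun l => W l i) j p = 0.
  by rewrite xE; exact: (@rdvd_eliminate _ _ (fun l => W l i)).
have x1 : x - 1 != 0.
  have xc : x@_0%MM = 0.
    apply: (dhomog_nemf_coeff hx); change (mdeg (0%MM : 'X_{1..m}) != 1%N).
    by rewrite mdeg0.
  apply: contraTneq isT => /(congr1 (mcoeff 0%MM)).
  rewrite mcoeffB xc mcoeff1 eqxx mcoeff0 sub0r => /eqP.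
  by rewrite oppr_eq0 oner_eq0.
have g1 : eliminate (fun l => W l i) j g != 0.
  apply/eqP => /elim[a Ea].
  have h0 : (0 : {mpoly K[m]}) \is 0.-homog by exact: dhomog0.
  have [|N [b Eb]] := dehomog_ideal_homog h0 hx hg; first by exists 0, a; rewrite mul0r add0r.
  move/eqP: Eb; rewrite mulr0 mulf_eq0 expf_eq0 (negbTE x0) andbF /=.
  by rewrite (negbTE g0).
case=> e [_ [w [[e' [u [w' [Uu ->]]]] ->]]] /eqP.
rewrite rmorphM rmorphXn rmorphB rmorph1 /= -/x mulf_eq0 expf_eq0 (negbTE x1) andbF /=.
rewrite rmorphD rmorphM /= addr_eq0 => /eqP E.
have : rdvd (x - 1) (lsubst W (f ^+ e' * (u + f * w'))).
  by exists (- lsubst W w); rewrite rmorphM /= E; ring.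
move/elim/eqP; rewrite rmorphM rmorphXn /= -/g rmorphM rmorphXn /=.
rewrite mulf_eq0 expf_eq0 (negbTE g1) andbF /= => /eqP/elim[a Ea].
have Pu : u + f * w' \in P 0%N.
  by apply/JP/secE; exists 0, a; rewrite mul0r add0r.
case/negP: (Uxs u Uu); have -> : u = (- w') * f + (u + f * w') by ring.
exact: PD.
Qed.

End DimensionUpper.

Section DimensionLower.
Local Open Scope ring_scope.
Variables (K : fieldType).

(** The morphism [tau] restricts to an affine line on which the variables in
    [js] vanish. Since g is not zero there, these variables can be cancelled
    and set to 0 one after the other, until g divides a nonzero constant. *)
Lemma boundary_not_rdvd m (js : seq 'I_m) (g v : {mpoly K[m]})
    (tau : {rmorphism {mpoly K[m]} -> {poly K}}) :
    uniq js -> (forall c, tau c%:MP = c%:P) -> (forall j, j \in js -> tau 'X_j = 0) ->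
    (1 < size (tau g))%N ->
    iterated_boundary (@nonzero_const K m) [seq 'X_j | j <- js] v ->
  ~ rdvd g v.
Proof.
move=> + tauC; elim: js g v => [|j js IHjs] g v /=.
  move=> _ _ size_g [c c0 ->] [a /(congr1 tau)]; rewrite rmorphM /= tauC => E.
  have a0 : tau a != 0.
    by apply: contraNneq c0 => E0; move/eqP: E; rewrite E0 mul0r polyC_eq0.
  have : size (tau a * tau g) = 1%N by rewrite -E size_polyC c0.
  rewrite size_mul //; last by rewrite -size_poly_gt0 ltnW.
  have : (0 < size (tau a))%N by rewrite size_poly_gt0.
  by move: (size (tau a)) (size (tau g)) size_g => x y; lia.
case/andP=> njs uniq_js tauX size_g [e [u [w [Uu ->]]]].
pose eps := msubst j (0 : {mpoly K[m]}).
have tau_eps p : tau (eps p) = tau p.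
  apply: (mpoly_rmorph_eq (g := tau \o msubst j 0) (h := tau)) => [c|i] /=.
    by rewrite msubstC.
  rewrite msubstXU; case: eqVneq => [->|//].
  by rewrite rmorph0 tauX ?mem_head.
have eps_g : eps g != 0.
  apply: contraTneq size_g => E; by rewrite -(tau_eps g) E rmorph0 size_poly0.
have cancelX z : rdvd g ('X_j ^+ e * z) -> rdvd g z.
  elim: e {Uu} => [|e IHe]; first by rewrite expr0 mul1r.
  rewrite exprS -mulrA => -[a Ea]; apply: IHe.
  have : msubst j 0 a = 0.
    have := congr1 eps Ea; rewrite /eps !rmorphM /= msubstXU eqxx mul0r => /esym/eqP.
    by rewrite mulf_eq0 (negbTE eps_g) orbF => /eqP.
  case/rdvd_XU=> b Eb; exists b; apply: (mulfI (mpolyXU_neq0 K j)).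
  by rewrite Ea Eb; ring.
move/cancelX => [a /(congr1 eps)]; rewrite /eps !rmorphD !rmorphM /= msubstXU eqxx.
rewrite mul0r addr0 => E; apply: (IHjs (eps g) (eps u)) => //.
- by move=> i ijs; apply: tauX; rewrite inE ijs orbT.
- by rewrite tau_eps.
- have -> : [seq 'X_i | i <- js] = map (msubst j (0 : {mpoly K[m]})) [seq 'X_i | i <- js].
    rewrite -map_comp; apply/eq_in_map => i ijs /=; rewrite msubstXU.
    by case: eqVneq ijs => // ->; rewrite (negbTE njs).
  apply: iterated_boundary_morph Uu => _ [c c0 ->]; exists c => //.
  exact: msubstC.
- by exists (eps a).
Qed.

(** The coordinates y_2, ..., y_(r+1) of the section provide a chain of length r,
    in a chart where the first two basis vectors span an affine line on which
    f is not constant. *)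
Lemma section_chain_exists r n (T : {vspace 'rV[K]_n.+1})
    (W : 'M[K]_(r.+2, n.+1)) (B : 'M[K]_(n.+1, r.+2)) (f : {mpoly K[n.+1]}) i :
    W *m B = 1%:M -> (forall v, v \in T <-> exists u, v = u *m W) ->
    W ord0 i = 1 -> W (lift ord0 ord0) i = 0 -> (1 < size (line idfun (W ord0) (W (lift ord0 ord0)) f))%N ->
  exists P,
    prime_chain (chart_ideal (scheme_inter (hypersurface f) (linear_subscheme T)) i) r P.
Proof.
move=> WB TW W0 W1 size_f; set J := chart_ideal _ i.
have secE p := chart_ideal_section WB TW f p i.
pose js : seq 'I_r.+2 := [seq rshift 2 j | j : 'I_r].
have uniq_js : uniq js by rewrite map_inj_uniq ?enum_uniq // => a b /(congr1 val)/addnI/val_inj.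
have size_js : size js = r by rewrite size_map size_enum_ord.
have js0 j : j \in js -> (1 < j)%N by case/mapP=> l _ ->.
pose xs := [seq lsubst B 'X_j | j <- js].
have [||||P] := @prime_chain_of_boundary _ J (@nonzero_const K n.+1) xs.
- exact: ideal_ideal_gen.
- by exists 1; rewrite ?oner_neq0 // mpolyC1.
- by move=> _ _ [a a0 ->] [b b0 ->]; exists (a * b); rewrite ?mulf_neq0 // mpolyCM.
- move=> v Uv /secE.
  have cW : (fun l => W l i) ord0 != 0 by rewrite W0 oner_neq0.
  pose h := eliminate (fun l => W l i) ord0.
  case=> a [b]; rewrite (lsubstXU W i) => /(congr1 h).
  rewrite /h rmorphD !rmorphM rmorphB rmorph1 /= (@eliminate_form _ _ (fun l => W l i) ord0 cW) subrr mulr0 addr0 => E.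
  have [tau [tauC tauX]] : exists tau : {rmorphism {mpoly K[r.+2]} -> {poly K}},
      (forall c, tau c%:MP = c%:P) /\
      (forall l, tau 'X_l = if l == ord0 then 1 else if l == lift ord0 ord0 then 'X else 0).
    exists (mmap polyC (fun l : 'I_r.+2 =>
      if l == ord0 then 1 else if l == lift ord0 ord0 then 'X else 0)).
    by split=> [c|l] /=; rewrite ?mmapC // mmapX mmap1U.
  have tauW p : tau (lsubst W p) = line idfun (W ord0) (W (lift ord0 ord0)) p.
    apply: (mpoly_rmorph_eq (g := tau \o lsubst W) (h := line idfun _ _)) => [c|j] /=.
      by rewrite lsubstC lineC tauC.
    rewrite lsubstXU lineXU rmorph_sum !big_ord_recl big1 => [|l _] /=.
      by rewrite -!mul_mpolyC !rmorphM /= !tauC !tauX /= mulr1 addr0 -mul_polyC.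
    by rewrite -mul_mpolyC rmorphM /= tauX mulr0.
  have tau_h p : tau (h p) = tau p.
    apply: (mpoly_rmorph_eq (g := tau \o eliminate (fun l => W l i) ord0) (h := tau)) => [c|l] /=.
      by rewrite eliminateC.
    have [->|nl0] := eqVneq l ord0; last by rewrite eliminateXU.
    rewrite /eliminate msubstXU eqxx -(lsubstXU W i) -mul_mpolyC rmorphB rmorphM rmorphB rmorph1 /=.
    by rewrite tauW lineXU W0 W1 scale0r addr0 subrr mulr0 subr0.
  apply: (@boundary_not_rdvd _ js (h (lsubst W f)) (h (lsubst W v)) tau uniq_js tauC).
  + move=> j /js0 j1; rewrite tauX.
    have /negbTE-> : j != ord0 by rewrite -val_eqE /= -lt0n ltnW.
    by have /negbTE-> : j != lift ord0 ord0 by rewrite -val_eqE /= gtn_eqF.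
  + by rewrite tau_h tauW.
  + have -> : [seq 'X_j | j <- js] =
        map (eliminate (fun l => W l i) ord0 \o lsubst W) xs.
      rewrite /xs -map_comp; apply/eq_in_map => j /js0 j1 /=.
      rewrite lsubst_lsubst WB lsubst1 eliminateXU //.
      by rewrite -val_eqE /= -lt0n ltnW.
    apply: iterated_boundary_morph Uv => _ [c c0 ->]; exists c => //=.
    by rewrite lsubstC eliminateC.
  + by exists (h a).
by rewrite size_map size_js; exists P.
Qed.

End DimensionLower.

(** * Planes through a transverse line *)

Section NormalizedLine.
Local Open Scope ring_scope.
Variables (K : fieldType) (n d : nat) (f : {mpoly K[n]}).
Hypotheses (d1 : (1 < d)%N) (hf : f \is d.-homog).

(** A form of degree at least 2 that is separable on a line is not constant
    there in the complementary chart; otherwise it would be a multiple of t^d. *)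
Lemma size_line_rev (a b : 'I_n -> K) :
  separable_poly (line idfun a b f) -> (1 < size (line idfun b a f))%N.
Proof.
move=> sep; rewrite ltnNge; apply/negP => /size1_polyC E.
have := separable_coef01 sep.
rewrite -(rev_line idfun b a hf) E -[_%:P]mulr1 revCM rev1.
by rewrite !coefCM !coefXn !ltn_eqF ?mulr0 ?eqxx // ltnW.
Qed.

Lemma line_neq0 (a b : 'I_n -> K) :
  separable_poly (line idfun a b f) -> exists i, a i != 0.
Proof.
move=> /size_line_rev size_l; apply/existsP; apply: contraLR size_l => /existsPn a0.
suff -> : line idfun b a f = (f.@[b])%:P by rewrite -leqNgt size_polyC_leq1.
apply: (mpoly_rmorph_eq (g := line idfun b a) (h := polyC \o meval b)) => [c|i] /=.
  by rewrite lineC mevalC.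
by rewrite lineXU mevalXU (eqP (negbNE (a0 i))) scale0r addr0.
Qed.

(** The points of a transverse line can be chosen such that the chart x_i = 1
    contains [b'] and has [a'] at infinity. *)
Lemma normalize_line (a b : 'I_n -> K) :
    f.@[b] != 0 -> separable_poly (line idfun a b f) ->
  exists (a' b' : 'I_n -> K) i, [/\ a' i = 0, b' i = 1, f.@[b'] != 0 &
    separable_poly (line idfun a' b' f)].
Proof.
move=> fb sep; set p := line idfun a b f in sep.
have pd : p`_d = f.@[b] by rewrite (coef_line_homog _ _ _ hf).
have size_p : size p = d.+1.
  apply/eqP; rewrite eqn_leq size_line //= ltnNge; apply: contra fb => le.
  by rewrite -pd nth_default.
have [i bi] : exists i, b i != 0.
  apply/existsP; apply: contraT => /existsPn b0.
  have E : p = (f.@[a])%:P.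
    apply: (mpoly_rmorph_eq (g := line idfun a b) (h := polyC \o meval a)) => [c|i] /=.
      by rewrite lineC mevalC.
    by rewrite lineXU mevalXU (eqP (negbNE (b0 i))) scale0r addr0.
  have := size_polyC_leq1 (f.@[a]); rewrite -E size_p ltnS leqn0 => /eqP d0.
  by move: d1; rewrite d0.
pose c := - (a i / b i); pose q := c%:P + (b i)^-1 *: 'X.
have size_q : size q = 2.
  by rewrite /q addrC size_addl size_scale ?invr_neq0 // size_polyX // ltnS size_polyC_leq1.
have Eq : p \Po q = line idfun (fun j => a j + b j * c) (fun j => b j * (b i)^-1) f.
  exact: line_comp.
exists (fun j => a j + b j * c), (fun j => b j * (b i)^-1), i; split.
- by rewrite /c mulrN mulrCA mulfV // mulr1 subrr.
- by rewrite mulfV.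
- have := coef_line_homog idfun (fun j => a j + b j * c) (fun j => b j * (b i)^-1) hf.
  rewrite -Eq => E; rewrite -[X in X != 0]E.
  have -> : d = (size (p \Po q)).-1 by rewrite size_comp_poly2 // size_p.
  by rewrite -lead_coefE lead_coef_eq0 -size_poly_eq0 size_comp_poly2 // size_p.
rewrite -Eq separableE deriv_comp.
have -> : q^`() = ((b i)^-1)%:P.
  by rewrite /q derivD derivC add0r derivZ derivX alg_polyC.
rewrite mulrC mul_polyC coprimepZr ?invr_neq0 //.
by rewrite coprimep_comp_poly // -separableE.
Qed.

End NormalizedLine.

Section FreeExtension.
Local Open Scope ring_scope.

Lemma free_extend (K : fieldType) (vT : vectType K) (s : seq vT) m :
    free s -> (size s <= m <= \dim {:vT})%N ->
  exists2 t, size (s ++ t) = m & free (s ++ t).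
Proof.
move=> free_s /andP[]; rewrite leq_eqVlt => /orP[/eqP<- _|].
  by exists [::]; rewrite cats0.
elim: m => // m IHm; rewrite ltnS leq_eqVlt => /orP[/eqP Em|ltm] lem.
  have [v sv] : exists v, v \notin <<s>>%VS.
    have /subvPn[v _ sv] : ~~ ({:vT} <= <<s>>)%VS.
      apply/negP => /dimvS; rewrite leqNgt => /negP[].
      by apply: leq_ltn_trans (dim_span s) _; rewrite Em.
    by exists v.
  exists [:: v]; first by rewrite size_cat addn1 Em.
  by rewrite cats1 (perm_free (permEl (perm_rcons _ _))) free_cons sv.
have [t size_t free_t] := IHm ltm (ltnW lem).
have [v sv] : exists v, v \notin <<s ++ t>>%VS.
  have /subvPn[v _ sv] : ~~ ({:vT} <= <<s ++ t>>)%VS.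
    apply/negP => /dimvS; rewrite leqNgt => /negP[].
    by apply: leq_ltn_trans (dim_span _) _; rewrite size_t.
  by exists v.
exists (rcons t v); rewrite -rcons_cat; first by rewrite size_rcons size_t.
by rewrite (perm_free (permEl (perm_rcons _ _))) free_cons sv.
Qed.

Lemma span_row_matrix (K : fieldType) n m (s : seq 'rV[K]_n) :
    free s -> size s = m ->
  let W := \matrix_(l < m, j < n) (s`_l) 0 j in
  (exists B, W *m B = 1%:M) /\
  (forall v, v \in <<s>>%VS <-> exists u, v = u *m W).
Proof.
move=> free_s size_s W.
have uW (u : 'rV_m) : u *m W = \sum_l u 0 l *: s`_l.
  rewrite mulmx_sum_row; apply: eq_bigr => l _; congr (_ *: _).
  by apply/rowP => j; rewrite !mxE.
have tup : size s == m by rewrite size_s.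
split.
  apply/row_freeP; rewrite -kermx_eq0; apply/rowV0P => u /sub_kermxP.
  rewrite uW => E; apply/rowP => l; rewrite mxE.
  have /freeP freeX : free (Tuple tup) by [].
  exact: (freeX (fun l => u 0 l) E l).
move=> v; split=> [vs|[u ->]].
  exists (\row_l coord (Tuple tup) l v); rewrite uW.
  rewrite {1}(coord_span (X := Tuple tup) vs); apply: eq_bigr => l _.
  by rewrite mxE.
rewrite uW rpred_sum // => l _; apply/memvZ/memv_span.
by rewrite mem_nth // size_s.
Qed.

End FreeExtension.

Theorem corollary4p8 (Fq : finFieldType) (n d : nat) (f : {mpoly Fq[n.+1]})
    (hn : 3 <= n) (hd : 2 <= d)
    (f_neq0 : (f != 0)%R) (f_homog : f \is d.-homog)
    (X_reduced : reduced_scheme (hypersurface f))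
    (hq : d * (d - 1) + 1 <= #|Fq|) :
  forall r : nat, 2 <= r <= n - 1 ->
  exists T : {vspace 'rV[Fq]_n.+1},
    [/\ (\dim T = r.+1)%VS,
        reduced_scheme (scheme_inter (hypersurface f) (linear_subscheme T))
      & has_dim (scheme_inter (hypersurface f) (linear_subscheme T)) (r - 1)].
Proof.
(* The dimension of the plane is r.+2 from here on. *)
case=> [|[|r]] // /andP[_ ler].
have redf : reduced_quotient (rdvd f).
  have n0 : (ord0 : 'I_n.+1) != ord_max by rewrite -val_eqE /=; lia.
  apply: (reduced_cone n0 f_homog) => i p m.
  have chartE q : chart_ideal (hypersurface f) i q <-> dehomog_ideal f ('X_i)%R q.
    split=> [|[A [B ->]]].
      apply: ideal_gen_min; first exact: ideal_dehomog_ideal.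
      move=> _ [->|->]; [exists 1%R, 0%R|exists 0%R, 1%R].
        by rewrite mul1r mul0r addr0.
      by rewrite mul0r mul1r add0r.
    have idJ : is_ideal (chart_ideal (hypersurface f) i) by exact: ideal_ideal_gen.
    apply: (idealD idJ); apply: (idealM idJ); apply: ideal_gen_mem; first by left.
    by right.
  by move=> /chartE/X_reduced/chartE.
have ltq : d * (d - 1) < #|Fq| by rewrite -addn1.
have [a0 [b0 [fb0 sep0]]] := exists_transverse_line hd f_neq0 f_homog redf ltq.
have [a [b [i [ai bi fb sep]]]] := normalize_line hd f_homog fb0 sep0.
have [j aj] := line_neq0 hd f_homog sep.
pose va : 'rV[Fq]_n.+1 := (\row_l a l)%R; pose vb : 'rV[Fq]_n.+1 := (\row_l b l)%R.
have free_ba : free [:: vb; va].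
  rewrite free_cons seq1_free span_seq1; apply/andP; split.
    apply/negP => /vlineP[c /rowP/(_ i)]; rewrite !mxE ai bi mulr0 => /eqP.
    by rewrite oner_eq0.
  by apply: contraNneq aj => /rowP/(_ j); rewrite !mxE => ->.
have [|t size_t free_t] := free_extend (m := r.+3) free_ba.
  by rewrite dimvf /= /dim /= mul1n; lia.
pose T : {vspace 'rV[Fq]_n.+1} := <<[:: vb; va] ++ t>>%VS; exists T.
set s := [:: vb; va] ++ t in size_t free_t T *.
have [[B WB] TW] := span_row_matrix free_t size_t.
set W := (\matrix_(l < r.+3, j < n.+1) (s`_l 0 j))%R in WB TW.
have W0 l : W ord0 l = b l by rewrite !mxE.
have W1 l : W (lift ord0 ord0) l = a l by rewrite !mxE.
have dimT : \dim T = r.+3 by rewrite -size_t; apply/eqP.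
(* The coordinates on T of the points b and a that span the line. *)
pose y0 (l : 'I_r.+3) : Fq := (l == ord0)%:R%R.
pose y1 (l : 'I_r.+3) : Fq := (l == lift ord0 ord0)%:R%R.
have yW0 j' : (\sum_l y0 l * W l j')%R = b j'.
  rewrite (bigD1 ord0) //= /y0 eqxx mul1r big1 ?addr0 ?W0 // => l /negbTE->.
  by rewrite mul0r.
have yW1 j' : (\sum_l y1 l * W l j')%R = a j'.
  rewrite (bigD1 (lift ord0 ord0)) //= /y1 eqxx mul1r big1 ?addr0 ?W1 // => l /negbTE->.
  by rewrite mul0r.
have gb : ((lsubst W f).@[y0] != 0)%R by rewrite meval_lsubst (meval_eq _ yW0).
have redg : reduced_quotient (rdvd (lsubst W f)).
  apply: (reduced_of_separable_line (lsubst_homog W f_homog) gb (a := y1)).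
  by rewrite line_lsubst (line_eq idfun f yW1 yW0).
split; first exact: dimT.
  exact: (reduced_section WB TW f_homog redg).
split=> [|i' l P chP]; last first.
  have := section_chain_leq WB TW f_homog _ chP.
  rewrite !ltnS; apply; apply: contraNneq gb => ->.
  by rewrite meval0.
exists i; apply: (section_chain_exists WB TW).
- by rewrite W0.
- by rewrite W1.
rewrite (line_eq idfun f W0 W1); exact: (size_line_rev hd f_homog).
Qed.
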